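(* Let $p=p(n)\in(0,1)$ satisfy $1-p=\Omega(1)$, and let $\ell=\ell(n)$ be a positive integer with $\ell=o(n\sqrt p)$. Let $X_{n,\ell}$ be the number of $\ell$-matchings contained in $\mathcal{G}(n,p)$, $\lambda_{n,\ell}=\mathbf{E}X_{n,\ell}$ and $\sigma_{n,\ell}=\sqrt{\mathrm{Var}(X_{n,\ell})}$. Then $$\frac{X_{n,\ell}-\lambda_{n,\ell}}{\sigma_{n,\ell}}\xrightarrow{d}\mathcal{N}(0,1)\quad\text{as } n\to\infty,$$ where $\mathcal{N}(0,1)$ is the standard normal distribution.
   Context: $\mathcal{G}(n,p)$ is the binomial random graph on vertex set $[n]$ in which each edge is present independently with probability $p$. An $\ell$-matching is a matching with exactly $\ell$ edges, and $X_{n,\ell}$ counts subgraphs of $\mathcal{G}(n,p)$ isomorphic to an $\ell$-matching. All asymptotics are as $n\to\infty$; $1-p=\Omega(1)$ means $1-p$ is bounded away from $0$. *)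

(* Defs.v *)
From HB Require Import structures.
From mathcomp Require Import all_boot all_order all_algebra.
From mathcomp Require Import all_classical all_reals all_analysis.
From mathcomp Require Import measurable_realfun.

Set Implicit Arguments.
Unset Strict Implicit.
Unset Printing Implicit Defensive.

Import Order.TTheory GRing.Theory Num.Theory.
Import numFieldNormedType.Exports.

Local Open Scope classical_set_scope.
Local Open Scope ring_scope.

Definition edge (n : nat) : Type := {e : {set 'I_n} | #|e| == 2}.
HB.instance Definition _ n := Finite.on (edge n).

(* A graph on the vertex set 'I_n is identified with its edge set. *)
Definition graph (n : nat) : Type := {set edge n}.
HB.instance Definition _ n := Finite.on (graph n).
HB.instance Definition _ n := isPointed.Build (graph n) (finset.set0 : {set edge n}).
HB.instance Definition _ n := @isMeasurable.Build default_measure_display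
  (graph n) (@discrete_measurable (graph n)) (@discrete_measurable0 (graph n))
  (@discrete_measurableC (graph n)) (@discrete_measurableU (graph n)).

(* Isolated vertices are left out: a subgraph isomorphic to an l-matching is
   determined by its l pairwise disjoint edges. *)
Definition is_matching (n l : nat) (M : graph n) : bool :=
  (#|M| == l) &&
  [forall e in M, forall f in M, (e != f) ==> [disjoint val e & val f]%B].

Definition matching_count (R : realType) (n l : nat) (G : graph n) : R :=
  #|[pred M : graph n | is_matching l M & M \subset G]|%:R.

Section gnp.
Context {R : realType} (n : nat).

(* [bernoulli_pmf p b] is [p] if [b] and [1 - p] otherwise, so this is
   p ^ e(G) * (1 - p) ^ ('C(n, 2) - e(G)). *)
Definition gnp_pmf (p : R) (G : graph n) : R :=
  \prod_(e : edge n) bernoulli_pmf p (e \in G).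

(* As for [bernoulli_prob], the value for [p] outside of [0, 1] is a dummy (the
   point mass at the empty graph) making [gnp p] a probability for every [p]. *)
Definition gnp (p : R) (A : set (graph n)) : \bar R :=
  if 0 <= p <= 1 then (\sum_(G \in A) (gnp_pmf p G)%:E)%E
  else \d_(finset.set0 : graph n) A.

Lemma gnp_pmf_ge0 (p : R) G : 0 <= p <= 1 -> 0 <= gnp_pmf p G.
Proof. by move=> p01; apply: prodr_ge0 => e _; exact: bernoulli_pmf_ge0. Qed.

Lemma gnp_pmf_subset (p : R) (S : {set edge n}) :
  \sum_(G : graph n | S \subset G) gnp_pmf p G = p ^+ #|S|.
Proof.
pose F (e : edge n) (b : bool) : R :=
  if (e \in S) && ~~ b then 0 else bernoulli_pmf p b.
transitivity (\prod_(e : edge n) \sum_(b : bool) F e b).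
  rewrite bigA_distr_bigA /=.
  rewrite (reindex (fun f : {ffun edge n -> bool} => [set e | f e]%SET)) /=; last first.
    exists (fun G : {set edge n} => [ffun e => e \in G]).
      by move=> f _; apply/ffunP => e; rewrite ffunE inE.
    by move=> G _; apply/setP => e; rewrite inE ffunE.
  rewrite [RHS](bigID (fun f : {ffun edge n -> bool} => S \subset [set e | f e]%SET)) /=.
  rewrite [X in _ = _ + X]big1 ?addr0 => [|f /fintype.subsetPn[e eS]]; last first.
    by rewrite inE => /negbTE fe; rewrite (bigD1 e) //= /F eS fe mul0r.
  apply: eq_bigr => f /fintype.subsetP Sf; rewrite /gnp_pmf; apply: eq_bigr => e _.
  rewrite inE /F; case: ifPn => // /andP[/Sf]; rewrite inE => ->//.
rewrite (eq_bigr (fun e => if e \in S then p else 1)) => [|e _].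
  by rewrite -big_mkcond prodr_const.
rewrite big_bool /F /=; case: (e \in S) => /=; first by rewrite addr0.
by rewrite addrC subrK.
Qed.

Lemma gnp_pmf_sum1 (p : R) : \sum_(G : graph n) gnp_pmf p G = 1.
Proof.
rewrite -[RHS](expr0 p) -(cards0 (edge n)) -gnp_pmf_subset.
by apply: eq_bigl => G; rewrite finset.sub0set.
Qed.

Let gnp0 (p : R) : gnp p set0 = 0%E.
Proof. by rewrite /gnp; case: ifPn => // _; rewrite fsbig_set0. Qed.

Let gnp_ge0 (p : R) A : (0 <= gnp p A)%E.
Proof.
rewrite /gnp; case: ifPn => // p01; rewrite fsbig_finite//= sumEFin lee_fin.
by apply: sumr_ge0 => G _; exact: gnp_pmf_ge0.
Qed.

Let gnp_sigma_additive (p : R) : semi_sigma_additive (gnp p).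
Proof.
move=> F mF tF mUF; rewrite /gnp; case: ifPn => p01; last first.
  exact: measure_semi_sigma_additive.
apply: cvg_toP.
  apply: ereal_nondecreasing_is_cvgn => i j ij.
  apply: lee_sum_nneg_natr => // k _ _; rewrite fsbig_finite//= sumEFin lee_fin.
  by apply: sumr_ge0 => G _; exact: gnp_pmf_ge0.
transitivity (\sum_(0 <= i <oo) (\esum_(G in F i) (gnp_pmf p G)%:E))%E.
  apply: eq_eseriesr => k _; rewrite esum_fset//= => G _.
  by rewrite lee_fin gnp_pmf_ge0.
rewrite -nneseries_sum_bigcup//=; last first.
  by move=> G; rewrite lee_fin gnp_pmf_ge0.
by rewrite esum_fset//= => G _; rewrite lee_fin gnp_pmf_ge0.
Qed.

HB.instance Definition _ (p : R) := isMeasure.Build _ _ _ (gnp p)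
  (gnp0 p) (gnp_ge0 p) (@gnp_sigma_additive p).

Lemma gnpE (p : R) (Q : pred (graph n)) : 0 <= p <= 1 ->
  gnp p [set G | Q G] = (\sum_(G : graph n | Q G) gnp_pmf p G)%:E.
Proof.
move=> p01; rewrite /gnp p01 -sumEFin.
rewrite (@bigfs _ _ _ _ (index_enum (graph n)) Q) ?index_enum_uniq//.
by move=> G _; rewrite mem_index_enum.
Qed.

Let gnp_setT (p : R) : gnp p [set: _] = 1%E.
Proof.
case: (boolP (0 <= p <= 1)) => p01; last by rewrite /gnp (negbTE p01) diracT.
rewrite (_ : [set: _] = [set G | predT G]); last by apply/seteqP; split.
by rewrite gnpE// gnp_pmf_sum1.
Qed.

HB.instance Definition _ (p : R) :=
  @Measure_isProbability.Build _ _ R (gnp p) (gnp_setT p).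

(* As [S] varies, this says that the edges are present independently, each with
   probability [p]. *)
Lemma gnp_subset (p : R) (S : {set edge n}) : 0 <= p <= 1 ->
  gnp p [set G | S \subset G] = (p ^+ #|S|)%:E.
Proof. by move=> p01; rewrite gnpE// gnp_pmf_subset. Qed.

Lemma matching_count_measurable (l : nat) :
  measurable_fun setT (@matching_count R n l).
Proof. by []. Qed.

HB.instance Definition _ (l : nat) := isMeasurableFun.Build _ _ _ _
  (@matching_count R n l) (@matching_count_measurable l).

End gnp.

Arguments gnp {R} n p.

Section standardize.
Context d {T : measurableType d} {R : realType} (P : probability T R).
Variable X : {RV P >-> R}.

Definition standardize (w : T) : R :=
  (X w - fine 'E_P[X]) / Num.sqrt (fine 'V_P[X]).

Lemma standardize_measurable : measurable_fun setT standardize.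
Proof. by apply: measurable_funM => //; exact: measurable_funB. Qed.

HB.instance Definition _ := isMeasurableFun.Build _ _ _ _
  standardize standardize_measurable.

End standardize.

Arguments standardize {d T R} P X w.

(* The random variables may live on different probability spaces. *)
Definition cvg_in_distribution (R : realType) (d : nat -> measure_display)
    (T : forall n, measurableType (d n)) (P : forall n, probability (T n) R)
    (X : forall n, {RV (P n) >-> R}) (mu : probability (measurableTypeR R) R) : Prop :=
  forall x : R, {for x, continuous (fun y : R => mu `]-oo, y]%classic)} ->
    cdf (X n) x @[n --> \oo] --> mu `]-oo, x]%classic.

Arguments cvg_in_distribution {R d T} P X mu.

(* Main.v *)
(* The count X of l-matchings is asymptotically a linear function of the number
   of edges.  Write q = (1 - p) / p, let N = 'C(n, 2), let m be the number of
   l-matchings of the complete graph and let lambda = m p^l.  Expanding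
   p^-|M :&: M'| = (1 + q)^|M :&: M'| over the subsets of M :&: M' gives
     Var X = p^(2 l) \sum_M \sum_(0 != S \subset M) q^|S| d(S),
   where d(S) counts the l-matchings containing S.  Vertex transpositions and
   double counting give d(S) <= m (l / N) (l / 'C(n - 2 l, 2))^(|S| - 1), so the
   sum is geometric and Var X is at most (lambda l)^2 q / (N (1 - eps)) with
   eps = l^2 q / 'C(n - 2 l, 2) = O(l^2 / (n^2 p)), which tends to 0.  Since
   Cov(X, e(G)) = lambda l (1 - p) and Var e(G) = N p (1 - p), the correlation of
   X and e(G) is at least sqrt (1 - eps), so that the standardized X and e(G) are
   close in L^2.

   The number of edges is binomial and its variance tends to infinity; its
   central limit theorem is proved without Stirling's formula.  In the window
   |x| <= K of standardized values, the ratio of consecutive binomial weights is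
   that of the Gaussian density up to a factor exp(O(h^2)), h being the mesh of
   the lattice.  The window has O(1 / h) points, so the weights are proportional
   to Gaussian masses up to a factor exp(O(h)), and Chebyshev's inequality
   identifies the proportionality constant. *)

Require Import Defs.
From HB Require Import structures.
From mathcomp Require Import all_boot all_order all_algebra perm.
From mathcomp Require Import all_classical all_reals all_analysis.
From mathcomp Require Import measurable_realfun zify lra.

Set Implicit Arguments.
Unset Strict Implicit.
Unset Printing Implicit Defensive.

Import Order.TTheory GRing.Theory Num.Theory.
Import numFieldNormedType.Exports.

Local Open Scope classical_set_scope.
Local Open Scope ring_scope.

(** * The standard normal distribution function *)

Section normal_cdf.
Context {R : realType}.
Local Notation mu := (@lebesgue_measure R).
Implicit Types x y : R.

Definition normal_cdf (x : R) : R := fine (normal_prob 0 1 `]-oo, x]).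

Lemma normal_cdfE x : normal_prob 0 1 `]-oo, x] = (normal_cdf x)%:E.
Proof. by rewrite fineK// fin_num_measure. Qed.

Lemma normal_cdf_ge0 x : 0 <= normal_cdf x.
Proof. by rewrite -lee_fin -normal_cdfE. Qed.

Lemma normal_cdf_le1 x : normal_cdf x <= 1.
Proof. by rewrite -lee_fin -normal_cdfE probability_le1. Qed.

Lemma normal_cdfB x y : x <= y ->
  normal_prob 0 1 `]x, y] = (normal_cdf y - normal_cdf x)%:E.
Proof.
move=> xy.
have : normal_prob 0 1 `]-oo, y] =
    (normal_prob 0 1 `]-oo, x] + normal_prob 0 1 `]x, y])%E.
  rewrite -measureU//=.
    by congr (normal_prob 0 1 _); rewrite -itv_bndbnd_setU.
  apply/seteqP; split => // z /= []; rewrite !in_itv/= => zx /andP[xz _].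
  by move: (lt_le_trans xz zx); rewrite ltxx.
rewrite !normal_cdfE.
have /fineK <- : normal_prob 0 1 `]x, y] \is a fin_num by rewrite fin_num_measure.
by move=> [->]; rewrite addrAC subrr add0r.
Qed.

Lemma normal_cdf_nondecreasing : {homo normal_cdf : x y / x <= y}.
Proof.
by move=> x y xy; rewrite -subr_ge0 -lee_fin -normal_cdfB.
Qed.

Let integral_cst_oc x y (c : R) : x <= y ->
  (\int[mu]_(t in `]x, y]) (cst c%:E) t = (c * (y - x))%:E)%E.
Proof.
move=> xy; rewrite integral_cst//= lebesgue_measure_itv/= lte_fin.
by case: ltgtP xy => [||->] //; rewrite ?subrr ?mulr0 ?mule0// EFinM.
Qed.

Lemma normal_cdfB_le x y (c : R) : x <= y ->
  (forall t, x < t <= y -> normal_pdf 0 1 t <= c) ->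
  normal_cdf y - normal_cdf x <= c * (y - x).
Proof.
move=> xy pc; rewrite -lee_fin -normal_cdfB// /normal_prob.
rewrite -integral_cst_oc//.
apply: ge0_le_integral => //=.
- by move=> t _; rewrite lee_fin normal_pdf_ge0.
- by apply/measurable_EFinP; apply: measurable_funTS; exact: measurable_normal_pdf.
Qed.

Lemma normal_cdfB_ge x y (c : R) : x <= y -> 0 <= c ->
  (forall t, x < t <= y -> c <= normal_pdf 0 1 t) ->
  c * (y - x) <= normal_cdf y - normal_cdf x.
Proof.
move=> xy c0 pc; rewrite -lee_fin -normal_cdfB// /normal_prob.
rewrite -integral_cst_oc//.
apply: ge0_le_integral => //=.
by apply/measurable_EFinP; apply: measurable_funTS; exact: measurable_normal_pdf.
Qed.

Let peak : R := normal_peak 1.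

Lemma normal_pdf01E x : normal_pdf 0 1 x = peak * expR (- x ^+ 2 / 2).
Proof. by rewrite normal_pdfE ?oner_neq0// /normal_fun subr0 expr1n. Qed.

Lemma normal_cdf_lip x y : x <= y ->
  normal_cdf y - normal_cdf x <= peak * (y - x).
Proof.
move=> xy; apply: normal_cdfB_le => // t _; apply: normal_pdf_ub.
exact: oner_neq0.
Qed.

Lemma normal_cdf_continuous : continuous normal_cdf.
Proof.
have p0 : 0 < peak by apply: normal_peak_gt0; exact: oner_neq0.
move=> x; apply/cvgrPdist_le => /= e e0; near=> t.
have : `|x - t| <= e / peak.
  by near: t; apply: cvgr_dist_le => //; rewrite divr_gt0.
rewrite ler_pdivlMr// mulrC => xt.
have [h|h] := leP x t.
  rewrite distrC ger0_norm ?subr_ge0 ?normal_cdf_nondecreasing//.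
  by apply: le_trans (normal_cdf_lip h) _; rewrite distrC ger0_norm ?subr_ge0 in xt.
have {}h := ltW h; rewrite ger0_norm ?subr_ge0 ?normal_cdf_nondecreasing//.
by apply: le_trans (normal_cdf_lip h) _; rewrite ger0_norm ?subr_ge0 in xt.
Unshelve. all: by end_near. Qed.

(** For [t] between [x] and [x + h], [|t ^+ 2 - x ^+ 2| / 2] is at most [h * (2 * K + 1) / 2], so
    the density varies by a factor of at most [expR ((K + 1) * h)] over one lattice cell. *)
Lemma normal_cdf_window x h K : `|x| <= K -> 0 <= h <= 1 ->
  peak * expR (- x ^+ 2 / 2) * h * expR (- ((K + 1) * h))
     <= normal_cdf (x + h) - normal_cdf x
     <= peak * expR (- x ^+ 2 / 2) * h * expR ((K + 1) * h).
Proof.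
move=> xK /andP[h0 h1].
have p0 : 0 <= peak by exact: normal_peak_ge0.
have xh : x <= x + h by rewrite lerDl.
move: (xK); rewrite ler_norml => /andP[Kx Kx'].
apply/andP; split.
  rewrite -[leLHS]mulrA [h * _]mulrC mulrA.
  rewrite [X in _ * X <= _](_ : h = (x + h) - x); last by rewrite addrAC subrr add0r.
  apply: normal_cdfB_ge => //; first by rewrite !mulr_ge0 ?expR_ge0.
  move=> t /andP[t1 t2]; rewrite normal_pdf01E -mulrA -expRD ler_wpM2l// ler_expR.
  nra.
rewrite -[leRHS]mulrA [h * _]mulrC mulrA.
rewrite [X in _ <= _ * X](_ : h = (x + h) - x); last by rewrite addrAC subrr add0r.
apply: normal_cdfB_le => //.
move=> t /andP[t1 t2]; rewrite normal_pdf01E -mulrA -expRD ler_wpM2l// ler_expR.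
nra.
Qed.


(** The identity is a random variable with normal law, so the limits of [normal_cdf] at both
    infinities follow from those of [cdf]. *)
Let idTR : measurableTypeR R -> R := idfun.

#[local] HB.instance Definition _ :=
  @isMeasurableFun.Build _ _ _ _ idTR (@measurable_id _ _ setT).

Let cdf_id x : cdf (idTR : {RV (normal_prob (0 : R) 1) >-> R}) x = (normal_cdf x)%:E.
Proof. by rewrite /cdf -normal_cdfE. Qed.

Lemma cvg_normal_cdfy : normal_cdf x @[x --> +oo] --> (1 : R).
Proof.
have := cvg_cdfy1 (idTR : {RV (normal_prob (0 : R) 1) >-> R}).
rewrite (_ : cdf _ = EFin \o normal_cdf); last by apply/funext => x; exact: cdf_id.
by move/fine_cvgP => [_].
Qed.

Lemma cvg_normal_cdfNy : normal_cdf x @[x --> -oo] --> (0 : R).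
Proof.
have := cvg_cdfNy0 (idTR : {RV (normal_prob (0 : R) 1) >-> R}).
rewrite (_ : cdf _ = EFin \o normal_cdf); last by apply/funext => x; exact: cdf_id.
by move/fine_cvgP => [_].
Qed.

End normal_cdf.

(** * Binomial weights near the mean *)

Section binomial_ratio.
Context {R : realType}.
Implicit Types p X h K y : R.

(** The bound [1 + u <= expR u] at [u = - (y - 2 * y ^+ 2)] is inverted; what remains is that [(1 +
    y) * (1 - y + 2 * y ^+ 2) = 1 + y ^+ 2 * (1 + 2 * y)] is at least 1. *)
Lemma expR_quadratic_le y : - (1 / 2) <= y -> expR (y - 2 * y ^+ 2) <= 1 + y.
Proof.
move=> y2; rewrite -(opprK (y - _)) expRN.
have h := expR_ge1Dx (- (y - 2 * y ^+ 2)).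
have h0 : 0 < 1 + (- (y - 2 * y ^+ 2)) by nra.
apply: (@le_trans _ _ (1 + (- (y - 2 * y ^+ 2)))^-1).
  by rewrite lef_pV2 // posrE ?expR_gt0.
rewrite -[leLHS]mul1r ler_pdivrMr//; nra.
Qed.

(* [b] and [a] stand for consecutive binomial weights, [X] for the standardized
   position of the latter and [h] for the mesh: the equation between them is
   [binomial_pmfS] rewritten in these variables. *)
Lemma gauss_ratio_bounds p X h K (a b : R) (C := 2 * (K + 1) ^+ 2 + 1) :
  0 < p < 1 -> 0 <= a -> 0 <= b -> `|X| <= K -> 0 <= h -> (K + 1) * h <= 1 / 2 ->
  b * (1 + (1 - p) * (X * h + h ^+ 2)) = a * (1 - p * X * h) ->
  b * expR ((X + h) ^+ 2 / 2) <= a * expR (X ^+ 2 / 2) * expR (C * h ^+ 2) /\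
  a * expR (X ^+ 2 / 2) <= b * expR ((X + h) ^+ 2 / 2) * expR (C * h ^+ 2).
Proof.
move=> /andP[p0 p1] a0 b0 XK h0 Kh ab.
have K0 : 0 <= K by apply: le_trans XK.
move: XK; rewrite ler_norml => /andP[KX XK].
have h1 : h <= 1 / 2 by nra.
have Xh : - (K * h) <= X * h <= K * h by apply/andP; split; nra.
case/andP: Xh => Xh1 Xh2.
set y := (1 - p) * (X * h + h ^+ 2) in ab *.
have [q0 q1] : 0 <= 1 - p /\ 1 - p <= 1 by split; lra.
have w1 : - ((K + 1) * h) <= X * h + h ^+ 2 by nra.
have w2 : X * h + h ^+ 2 <= (K + 1) * h by nra.
have y1 : - ((K + 1) * h) <= y by rewrite /y; nra.
have y2 : y <= (K + 1) * h by rewrite /y; nra.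
set z := p * X * h in ab *.
have z1 : - (K * h) <= z by rewrite /z; nra.
have z2 : z <= K * h by rewrite /z; nra.
have yy : y ^+ 2 <= ((K + 1) * h) ^+ 2 by nra.
have zz : z ^+ 2 <= ((K + 1) * h) ^+ 2 by nra.
have e1 := expR_quadratic_le (y := y) ltac:(lra).
have e2 := expR_ge1Dx y.
have e3 := expR_quadratic_le (y := - z) ltac:(nra).
have e4 := expR_ge1Dx (- z).
have hh : 0 <= h ^+ 2 by exact: sqr_ge0.
have Cy : 2 * y ^+ 2 + h ^+ 2 / 2 <= C * h ^+ 2 by rewrite /C; nra.
have Cz : 2 * z ^+ 2 + h ^+ 2 / 2 <= C * h ^+ 2 by rewrite /C; nra.
(* Over one step [X ^+ 2 / 2] grows by [X * h + h ^+ 2 / 2], which [y + z] matches up to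
   [h ^+ 2 / 2]. Together with [2 * y ^+ 2] or [2 * z ^+ 2], this error is absorbed by
   [C * h ^+ 2]. *)
have yz : y + z = X * h + (1 - p) * h ^+ 2 by rewrite /y /z; lra.
split.
- have : b * expR (y - 2 * y ^+ 2) <= a * expR (- z).
    apply: le_trans (_ : b * (1 + y) <= _); first exact: ler_wpM2l.
    by rewrite ab; apply: ler_wpM2l.
  move=> bad.
  rewrite -(ler_pM2r (expR_gt0 (y - 2 * y ^+ 2))) mulrAC.
  apply: le_trans (ler_wpM2r (expR_ge0 _) bad) _.
  rewrite -!mulrA -!expRD ler_wpM2l// ler_expR; nra.
- have : a * expR (- z - 2 * (- z) ^+ 2) <= b * expR y.
    apply: le_trans (_ : a * (1 - z) <= _); first exact: ler_wpM2l.
    by rewrite -ab; apply: ler_wpM2l.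
  move=> bad.
  rewrite -(ler_pM2r (expR_gt0 (- z - 2 * (- z) ^+ 2))) mulrAC.
  apply: le_trans (ler_wpM2r (expR_ge0 _) bad) _.
  rewrite -!mulrA -!expRD ler_wpM2l// ler_expR; nra.
Qed.

End binomial_ratio.

(** * The de Moivre-Laplace theorem in a bounded window *)

Section de_moivre_laplace.
Context {R : realType} (n : nat) (p : R).
Hypothesis p01 : 0 < p < 1.

Let s := Num.sqrt (n%:R * p * (1 - p)).
Let h := s^-1.
Let dev (k : nat) : R := (k%:R - n%:R * p) / s.

Lemma binomial_pmfS k : (k < n)%N ->
  k.+1%:R * (1 - p) * binomial_pmf n p k.+1 = (n%:R - k%:R) * p * binomial_pmf n p k.
Proof.
move=> kn; rewrite /binomial_pmf -(natrB _ (ltnW kn)) -(mulr_natr _ 'C(n, k.+1)).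
rewrite -(mulr_natr _ 'C(n, k)) -(subnSK kn) !exprS /unstable.onem.
have := mul_bin_left n k; rewrite -(subnSK kn) => /(congr1 (fun m => m%:R : R)).
rewrite !natrM; move: (p ^+ k) ((1 - p) ^+ (n - k.+1)) (k.+1%:R)
  ((n - k.+1).+1%:R) ('C(n, k)%:R) ('C(n, k.+1)%:R).
move=> a b c d e f cf.
have -> : c * (1 - p) * (p * a * b * f) = p * a * (1 - p) * b * (c * f) by lra.
by rewrite cf; lra.
Qed.

Variable K : R.
Hypothesis s_gt0 : 0 < s.
Hypothesis K_ge0 : 0 <= K.
Hypothesis Kh : (K + 1) * h <= 1 / 2.

Let h_gt0 : 0 < h. Proof. by rewrite invr_gt0. Qed.
Let sh : s * h = 1. Proof. by rewrite divff// gt_eqF. Qed.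
Let s2 : s ^+ 2 = n%:R * p * (1 - p).
Proof.
case/andP: p01 => p0 p1.
by rewrite sqr_sqrtr// !mulr_ge0// ltW// subr_gt0.
Qed.

Let devS k : dev k.+1 = dev k + h.
Proof. by rewrite /dev -natr1 -/h; lra. Qed.

Let devE k : k%:R = n%:R * p + s * dev k.
Proof. by rewrite /dev mulrCA divff ?gt_eqF//; lra. Qed.

(** Up to a constant, the ratio of the binomial weight to the Gaussian density; it is nearly
    constant in the window. *)
Let weight k := binomial_pmf n p k * expR (dev k ^+ 2 / 2).
Let C := 2 * (K + 1) ^+ 2 + 1.

Let pmf_ge0 k : 0 <= binomial_pmf n p k.
Proof. by apply: binomial_pmf_ge0; case/andP: p01 => /ltW -> /ltW ->. Qed.

Let weight_step k : `|dev k| <= K ->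
  weight k.+1 <= weight k * expR (C * h ^+ 2) /\
  weight k <= weight k.+1 * expR (C * h ^+ 2).
Proof.
move=> kK; rewrite /weight devS; apply: (gauss_ratio_bounds p01) => //.
  exact: ltW.
case/andP: p01 => p0 p1; move: (kK); rewrite ler_norml => /andP[Kk kK'].
have h0 := ltW h_gt0.
(* Both coefficients of [binomial_pmfS] are written as multiples of [s ^+ 2], which cancels and
   leaves the equation required by [gauss_ratio_bounds]. *)
have sz : (n%:R - k%:R) * p = s ^+ 2 * (1 - p * dev k * h).
  have -> : s ^+ 2 * (1 - p * dev k * h) = s ^+ 2 - p * dev k * s * (s * h) by lra.
  by rewrite sh s2 {1}(devE k); lra.
have z2 : p * (dev k * h) <= 1 / 2.
  have a1 : dev k * h <= K * h by rewrite ler_wpM2r.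
  have a2 : p * (dev k * h) <= p * (K * h) by rewrite ler_wpM2l// ltW.
  have a3 : 0 <= (1 - p) * (K * h) by rewrite !mulr_ge0// subr_ge0 ltW.
  by have := Kh; lra.
have kn : (k < n)%N.
  rewrite ltnNge; apply/negP; rewrite -(ler_nat R) => nk.
  have : 0 < (n%:R - k%:R) * p by rewrite sz mulr_gt0 ?exprn_gt0//; lra.
  by rewrite pmulr_lgt0// subr_gt0 ltNge nk.
have sy : k.+1%:R * (1 - p) = s ^+ 2 * (1 + (1 - p) * (dev k * h + h ^+ 2)).
  have -> : s ^+ 2 * (1 + (1 - p) * (dev k * h + h ^+ 2)) =
    s ^+ 2 + (1 - p) * (dev k * s * (s * h) + (s * h) ^+ 2) by lra.
  by rewrite sh s2 -natr1 {1}(devE k); lra.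
have s20 : s ^+ 2 != 0 by rewrite expf_neq0// gt_eqF.
by apply: (mulfI s20); rewrite mulrCA [RHS]mulrCA mulrC -sy binomial_pmfS// sz; lra.
Qed.

Let dev_le : {homo dev : j k / (j <= k)%N >-> j <= k}.
Proof. by move=> j k jk; rewrite /dev ler_pM2r// lerD2r ler_nat. Qed.

Let weight_iter j d : `|dev j| <= K -> `|dev (j + d)| <= K ->
  weight (j + d) <= weight j * expR (C * h ^+ 2 * d%:R) /\
  weight j <= weight (j + d) * expR (C * h ^+ 2 * d%:R).
Proof.
move=> jK; elim: d => [_|d IH]; first by rewrite addn0 mulr0 expR0 mulr1.
rewrite addnS => dK.
have dK' : `|dev (j + d)| <= K.
  move: jK dK; rewrite !ler_norml => /andP[a _] /andP[_ b].
  by rewrite (le_trans a) ?dev_le ?leq_addr//= (le_trans _ b)// dev_le.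
have [h1 h2] := IH dK'; have [h3 h4] := weight_step dK'.
rewrite -natr1 mulrDr mulr1 expRD; split.
  rewrite (le_trans h3)// mulrA; apply: ler_wpM2r => //; exact: expR_ge0.
apply: le_trans h2 _; apply: le_trans (ler_wpM2r (expR_ge0 _) h4) _; lra.
Qed.

(** Two points of the window are at most [2 * K / h] lattice steps apart, and each step costs a
    factor [expR (C * h ^+ 2)]. *)
Let weight_compare j k : `|dev j| <= K -> `|dev k| <= K ->
  weight k <= weight j * expR (2 * K * C * h).
Proof.
have aux i d : `|dev i| <= K -> `|dev (i + d)| <= K ->
    expR (C * h ^+ 2 * d%:R) <= expR (2 * K * C * h).
  move=> jK dK; rewrite ler_expR.
  have : h * d%:R <= 2 * K.
    move: jK dK; rewrite !ler_norml => /andP[a _] /andP[_ b].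
    have : dev (i + d) - dev i = h * d%:R by rewrite /dev natrD -/h; lra.
    lra.
  have : 0 <= C by rewrite /C addr_ge0// mulr_ge0// sqr_ge0.
  have := h_gt0; move=> h0 C0 hd.
  have -> : C * h ^+ 2 * d%:R = C * h * (h * d%:R) by lra.
  have -> : 2 * K * C * h = C * h * (2 * K) by lra.
  by rewrite ler_wpM2l// mulr_ge0// ltW.
have w0 i : 0 <= weight i by rewrite mulr_ge0 ?expR_ge0.
move=> jK kK; have [jk|/ltnW kj] := leqP j k.
  move: (kK); rewrite -(subnKC jk) => kK'.
  have [+ _] := weight_iter jK kK'; move=> /le_trans; apply.
  by rewrite ler_wpM2l// (aux j).
move: (jK); rewrite -(subnKC kj) => jK'.
have [_ +] := weight_iter kK jK'; move=> /le_trans; apply.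
by rewrite ler_wpM2l// (aux k).
Qed.

Let inc k := normal_cdf (dev k.+1) - normal_cdf (dev k).
(** [2 * K * C] comes from [weight_compare], and [K + 1] from each of two uses of
    [normal_cdf_window]. *)
Let D := 2 * K * C + 2 * (K + 1).

(** Says that the ratio of binomial weight to Gaussian cell mass is constant in the window up to
    [expR (D * h)]. The cross-multiplied form can be summed over [j] and [k] independently. *)
Let pmf_inc_compare j k : `|dev j| <= K -> `|dev k| <= K ->
  binomial_pmf n p k * inc j <= expR (D * h) * (binomial_pmf n p j * inc k).
Proof.
move=> jK kK; rewrite /inc !devS.
have h01 : 0 <= h <= 1.
  have h0 := h_gt0; have Kh0 := mulr_ge0 K_ge0 (ltW h0); have := Kh.
  by move=> ?; apply/andP; split; lra.
have /andP[_ uj] := normal_cdf_window jK h01.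
have /andP[lk _] := normal_cdf_window kK h01.
have := weight_compare jK kK; rewrite /weight => w.
have pmfE i : binomial_pmf n p i =
    binomial_pmf n p i * expR (dev i ^+ 2 / 2) * expR (- dev i ^+ 2 / 2).
  by rewrite -mulrA -expRD mulNr subrr expR0 mulr1.
apply: le_trans (ler_wpM2l (pmf_ge0 k) uj) _.
apply: le_trans (_ : expR (D * h) * (binomial_pmf n p j * _) <= _); last first.
  by apply: ler_wpM2l; [exact: expR_ge0|apply: ler_wpM2l; [exact: pmf_ge0|exact: lk]].
rewrite [in leLHS]pmfE [binomial_pmf n p j]pmfE.
set P := normal_peak 1; have P0 : 0 <= P by exact: normal_peak_ge0.
set ek := expR (- dev k ^+ 2 / 2); set ej := expR (- dev j ^+ 2 / 2).
set c := P * ek * ej * h.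
have c0 : 0 <= c by rewrite !mulr_ge0 ?expR_ge0// ltW.
set wk := _ * expR (dev k ^+ 2 / 2) in w *.
set wj := _ * expR (dev j ^+ 2 / 2) in w *.
have -> : wk * ek * (P * ej * h * expR ((K + 1) * h)) =
  c * (wk * expR ((K + 1) * h)) by rewrite /c; lra.
have -> : expR (D * h) * (wj * ej * (P * ek * h * expR (- ((K + 1) * h)))) =
  c * (wj * (expR (D * h) * expR (- ((K + 1) * h)))) by rewrite /c; lra.
apply: ler_wpM2l => //; apply: le_trans (ler_wpM2r (expR_ge0 _) w) _.
rewrite -(mulrA wj) -!expRD; apply: ler_wpM2l.
  by rewrite mulr_ge0 ?expR_ge0.
by rewrite ler_expR /D; lra.
Qed.

Let sum_inc a b : (a <= b)%N ->
  \sum_(a <= k < b) inc k = normal_cdf (dev b) - normal_cdf (dev a).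
Proof. by move=> ab; rewrite (telescope_sumr (normal_cdf \o dev)). Qed.

(** The mesh condition gives [K <= s], so [K * s <= s ^+ 2 <= n%:R * p]. This keeps the arguments of
    [truncn] nonnegative, where it is the integer part. *)
Lemma binomial_window_ge0 : 0 <= n%:R * p - K * s.
Proof.
case/andP: p01 => p0 p1.
have : K <= s.
  have : (K + 1) * h * s <= 1 / 2 * s by rewrite ler_pM2r.
  rewrite -mulrA [h * s]mulrC sh; have := s_gt0; lra.
have : s * s <= n%:R * p.
  by rewrite -expr2 s2 -[leRHS]mulr1 ler_wpM2l// ?mulr_ge0//; lra.
have := s_gt0; nra.
Qed.

(* With [W] the standardized binomial variable, the two sums are
   P(-K < W <= x) and P(-K < W <= K). *)
Lemma binomial_normal_window x (D' := 2 * K * (2 * (K + 1) ^+ 2 + 1) + 2 * (K + 1))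
    (m := (Num.truncn (n%:R * p - K * s)).+1)
    (A := \sum_(m <= k < (Num.truncn (n%:R * p + x * s)).+1) binomial_pmf n p k)
    (B := \sum_(m <= k < (Num.truncn (n%:R * p + K * s)).+1) binomial_pmf n p k) :
  - K <= x <= K -> B <= 1 ->
  A * (normal_cdf K - normal_cdf (- K + h)) <= expR (D' * h) * normal_cdf (x + h) /\
  B * (normal_cdf x - normal_cdf (- K + h)) <= expR (D' * h) * A.
Proof.
move=> /andP[Kx xK] B1.
have s0 := s_gt0; have h0 := h_gt0.
(* For [y] in the window, [N y] is the first index whose standardized value exceeds [y], so rounding
   to the lattice moves [y] by at most [h]. *)
pose N (y : R) := (Num.truncn (n%:R * p + y * s)).+1.
have pos y : - K <= y -> 0 <= n%:R * p + y * s.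
  by move=> Ky; apply: le_trans binomial_window_ge0 _; rewrite lerD2l -mulNr ler_pM2r.
have mE : m = N (- K) by rewrite /m /N mulNr.
have Nle y y' : y <= y' -> (N y <= N y')%N.
  by move=> yy; rewrite ltnS; apply: le_truncn; rewrite lerD2l ler_pM2r.
have devN y : y <= dev (N y).
  rewrite /dev ler_pdivlMr// lerBrDl; apply/ltW; exact: truncnS_gt.
have devN' y : - K <= y -> dev (N y) <= y + h.
  move=> Ky; rewrite /N devS lerD2r /dev ler_pdivrMr// lerBlDl.
  by rewrite truncn_le// pos.
have win y k : - K <= y -> y <= K -> (m <= k < N y)%N -> `|dev k| <= K.
  move=> Ky yK /andP[mk kN]; rewrite ler_norml; apply/andP; split.
    by apply: le_trans (devN _) (dev_le _); rewrite -mE.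
  apply: le_trans yK; rewrite /dev ler_pdivrMr// lerBlDl.
  apply: le_trans (_ : (Num.truncn (n%:R * p + y * s))%:R <= _).
    by rewrite ler_nat -ltnS.
  by rewrite truncn_le// pos.
have KK : - K <= K by lra.
(* Summing [pmf_inc_compare] over all pairs gives products of sums, and the Gaussian ones
   telescope. *)
have cmp y z : - K <= y -> y <= K -> - K <= z -> z <= K ->
    (\sum_(m <= k < N y) binomial_pmf n p k) * (\sum_(m <= k < N z) inc k) <=
    expR (D * h) *
    ((\sum_(m <= k < N z) binomial_pmf n p k) * (\sum_(m <= k < N y) inc k)).
  move=> Ky yK Kz zK.
  rewrite [X in _ <= _ * X]mulrC !mulr_suml mulr_sumr big_nat [leRHS]big_nat.
  apply: ler_sum => k km; rewrite !mulr_sumr big_nat [leRHS]big_nat.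
  apply: ler_sum => j jm.
  rewrite [inc k * _]mulrC; apply: pmf_inc_compare; [exact: (win z)|exact: (win y)].
have h1 := cmp x K Kx xK KK (lexx _); have h2 := cmp K x KK (lexx _) Kx xK.
have mNx : (m <= N x)%N by rewrite mE Nle.
have mNK : (m <= N K)%N by rewrite mE Nle.
rewrite !sum_inc// -/A -/B -/(N _) in h1 h2.
rewrite -/(N x) -/(N K) -/A -/B in h1 h2.
have A0 : 0 <= A by apply: sumr_ge0.
have B0 : 0 <= B by apply: sumr_ge0.
have e0 := expR_ge0 (D * h).
have cm : normal_cdf (dev m) <= normal_cdf (- K + h).
  by apply: normal_cdf_nondecreasing; rewrite mE devN'.
have cx : normal_cdf (dev (N x)) <= normal_cdf (x + h).
  by apply: normal_cdf_nondecreasing; exact: devN'.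
have cx' : normal_cdf x <= normal_cdf (dev (N x)).
  by apply: normal_cdf_nondecreasing.
have cK : normal_cdf K <= normal_cdf (dev (N K)).
  by apply: normal_cdf_nondecreasing.
have c1 := normal_cdf_le1 (dev (N K)).
have c0 := normal_cdf_ge0 (dev m).
have c2 := normal_cdf_ge0 (x + h).
have cmx : normal_cdf (dev m) <= normal_cdf (dev (N x)).
  by apply: normal_cdf_nondecreasing; exact: dev_le.
rewrite -/D; split.
  apply: le_trans (ler_wpM2l A0 (lerB cK cm)) _.
  apply: le_trans h1 (ler_wpM2l e0 _).
  apply: le_trans (ler_piMl _ B1) _; first by rewrite subr_ge0.
  by rewrite lerBlDr; apply: le_trans cx _; rewrite lerDl; exact: c0.
apply: le_trans (ler_wpM2l B0 (lerB cx' cm)) _.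
apply: le_trans h2 (ler_wpM2l e0 _).
by apply: (ler_piMr A0); rewrite lerBlDr; apply: le_trans c1 _; rewrite lerDl; exact: c0.
Qed.

End de_moivre_laplace.

(** * Moments in the binomial random graph *)

Section gnp_mean.
Context {R : realType} (n : nat) (p : R).
Implicit Types (f g : graph n -> R) (S T : {set edge n}).

(** A finite sum in place of an integral, so that moments are computed by exchanging sums;
    [gnp_expectation] and [gnp_variance] give the link to the measure-theoretic notions. *)
Definition gnp_mean f : R := \sum_(G : graph n) gnp_pmf p G * f G.

Lemma eq_gnp_mean f g : f =1 g -> gnp_mean f = gnp_mean g.
Proof. by move=> fg; apply: eq_bigr => G _; rewrite fg. Qed.

Lemma gnp_meanD f g : gnp_mean (fun G => f G + g G) = gnp_mean f + gnp_mean g.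
Proof. by rewrite -big_split; apply: eq_bigr => G _; rewrite mulrDr. Qed.

Lemma gnp_meanZ c f : gnp_mean (fun G => c * f G) = c * gnp_mean f.
Proof. by rewrite mulr_sumr; apply: eq_bigr => G _; rewrite mulrCA. Qed.

Lemma gnp_mean_cst c : gnp_mean (fun=> c) = c.
Proof. by rewrite /gnp_mean -mulr_suml gnp_pmf_sum1 mul1r. Qed.

Lemma gnp_mean_sum (I : finType) (P : pred I) (F : I -> graph n -> R) :
  gnp_mean (fun G => \sum_(i | P i) F i G) = \sum_(i | P i) gnp_mean (F i).
Proof.
rewrite exchange_big; apply: eq_bigr => G _; exact: mulr_sumr.
Qed.

Lemma gnp_mean_pred (Q : pred (graph n)) :
  gnp_mean (fun G => (Q G)%:R) = \sum_(G : graph n | Q G) gnp_pmf p G.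
Proof.
by rewrite [RHS]big_mkcond; apply: eq_bigr => G _; case: (Q G); rewrite ?mulr1 ?mulr0.
Qed.

Lemma gnp_mean_subset S : gnp_mean (fun G => (S \subset G)%:R) = p ^+ #|S|.
Proof. by rewrite gnp_mean_pred gnp_pmf_subset. Qed.

Lemma gnp_mean_subset2 S T :
  gnp_mean (fun G => (S \subset G)%:R * (T \subset G)%:R) = p ^+ #|S :|: T|%SET.
Proof.
rewrite -gnp_mean_subset; apply: eq_bigr => G _.
by rewrite finset.subUset -mulnb natrM.
Qed.

Hypothesis p01 : 0 <= p <= 1.

Lemma gnp_mean_ge0 f : (forall G, 0 <= f G) -> 0 <= gnp_mean f.
Proof. by move=> f0; apply: sumr_ge0 => G _; rewrite mulr_ge0 ?gnp_pmf_ge0. Qed.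

Lemma gnp_mean_le f g : (forall G, f G <= g G) -> gnp_mean f <= gnp_mean g.
Proof. by move=> fg; apply: ler_sum => G _; rewrite ler_wpM2l ?gnp_pmf_ge0. Qed.

Lemma gnp_integrable f : (gnp n p).-integrable setT (EFin \o f).
Proof.
apply: (@measurable_bounded_integrable _ _ _ (gnp n p)) => //.
  by rewrite -ge0_fin_numE// fin_num_measure.
exists (\sum_(G : graph n) `|f G|); split; first by rewrite num_real.
move=> M /ltW fM G _; apply: le_trans fM.
by rewrite (bigD1 G)//= lerDl sumr_ge0.
Qed.

Lemma gnp_expectation f : ('E_(gnp n p)[f] = (gnp_mean f)%:E)%E.
Proof.
(* On a finite space, [f] is a combination of indicators of points, which reduces the integral to
   the masses of points. *)
have fE : f = fun G => \sum_(H : graph n) f H * \1_[set H] G.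
  apply/funext => G; rewrite (bigD1 G)//= indicE mem_set// mulr1 big1 ?addr0//.
  by move=> H HG; rewrite indicE memNset ?mulr0// => GH; rewrite GH eqxx in HG.
rewrite unlock {1}fE.
under eq_integral do rewrite -sumEFin.
rewrite integral_sum//; last first.
  by move=> H; apply: (gnp_integrable (fun G => f H * \1_[set H] G)).
rewrite /gnp_mean -sumEFin; apply: eq_bigr => H _.
under eq_integral do rewrite EFinM.
rewrite integralZl//; last exact: gnp_integrable.
rewrite integral_indic// setIT.
transitivity ((f H)%:E * (gnp_pmf p H)%:E)%E; last by rewrite mulrC EFinM.
congr (_ * _)%E; transitivity (gnp n p [set G | pred1 H G]).
  by congr (gnp n p _); apply/seteqP; split => G /= /eqP.
by rewrite gnpE// big_pred1_eq.
Qed.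

Lemma gnp_variance f :
  ('V_(gnp n p)[f] = (gnp_mean (fun G => (f G - gnp_mean f) ^+ 2))%:E)%E.
Proof.
by rewrite /variance unlock gnp_expectation /= gnp_expectation.
Qed.

Lemma gnp_chebyshev f (P : pred (graph n)) (a : R) : 0 < a ->
  (forall G, P G -> a <= `|f G|) ->
  \sum_(G : graph n | P G) gnp_pmf p G <= gnp_mean (fun G => f G ^+ 2) / a ^+ 2.
Proof.
move=> a0 Pf; rewrite -gnp_mean_pred mulrC -gnp_meanZ; apply: gnp_mean_le => G.
have a20 : 0 < a ^+ 2 by rewrite exprn_gt0.
rewrite ler_pdivlMl//; case: (boolP (P G)) => [/Pf af|_]; last first.
  by rewrite mulr0 sqr_ge0.
by rewrite mulr1 -(real_normK (num_real (f G))) lerXn2r ?nnegrE// ltW.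
Qed.

Lemma card_edges_sum (G : graph n) : #|G|%:R = \sum_(e : edge n) ([set e]%SET \subset G)%:R :> R.
Proof.
rewrite -sum1_card natr_sum big_mkcond; apply: eq_bigr => e _.
by rewrite finset.sub1set; case: (e \in G).
Qed.

Let N := #|{: edge n}|.

Lemma gnp_mean_edges : gnp_mean (fun G => #|G|%:R) = N%:R * p.
Proof.
rewrite (eq_gnp_mean card_edges_sum) gnp_mean_sum (eq_bigr (fun=> p)).
  by rewrite sumr_const mulr_natl.
by move=> e _; rewrite gnp_mean_subset cards1 expr1.
Qed.

(** Adding an edge to [S] enlarges it only if the edge lies outside [S]. A single edge as [S] gives
    the variance of the number of edges, a matching gives the covariance with [X]. *)
Lemma gnp_mean_subset_edges S :
  gnp_mean (fun G => (S \subset G)%:R * #|G|%:R) =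
  #|S|%:R * p ^+ #|S| + (N%:R - #|S|%:R) * p ^+ #|S|.+1.
Proof.
under eq_gnp_mean do rewrite card_edges_sum mulr_sumr.
rewrite gnp_mean_sum (bigID (mem S)) /=; congr (_ + _).
  rewrite (eq_bigr (fun=> p ^+ #|S|)) ?sumr_const ?mulr_natl//.
  move=> e eS; rewrite gnp_mean_subset2; congr (_ ^+ #|pred_of_set _|).
  by rewrite finset.setUC; apply/finset.setUidPr; rewrite finset.sub1set.
rewrite (eq_bigr (fun=> p ^+ #|S|.+1)).
  rewrite sumr_const -natrB ?max_card// mulr_natl; congr (_ *+ _).
  by rewrite /N -(cardC (mem S)) addKn; apply: eq_card.
by move=> e eS; rewrite gnp_mean_subset2 finset.setUC cardsU1 eS.
Qed.

Lemma gnp_var_edges :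
  gnp_mean (fun G => (#|G|%:R - N%:R * p) ^+ 2) = N%:R * p * (1 - p).
Proof.
have E2 : gnp_mean (fun G => #|G|%:R * #|G|%:R) = N%:R * (p + (N%:R - 1) * p ^+ 2).
  under eq_gnp_mean do rewrite {1}card_edges_sum mulr_suml.
  rewrite gnp_mean_sum (eq_bigr (fun=> p + (N%:R - 1) * p ^+ 2)).
    by rewrite sumr_const mulr_natl.
  by move=> e _; rewrite gnp_mean_subset_edges cards1 expr1 mul1r.
transitivity (gnp_mean (fun G => #|G|%:R * #|G|%:R + ((- 2 * (N%:R * p)) * #|G|%:R
   + (N%:R * p) ^+ 2))).
  by apply: eq_bigr => G _; congr (_ * _); lra.
by rewrite !gnp_meanD gnp_meanZ gnp_mean_cst E2 gnp_mean_edges; lra.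
Qed.

Lemma gnp_pmfE (G : graph n) : gnp_pmf p G = p ^+ #|G| * (1 - p) ^+ (N - #|G|).
Proof.
rewrite /gnp_pmf (bigID (mem G)) /=; congr (_ * _).
  by rewrite (eq_bigr (fun=> p)) ?prodr_const// => e eG; rewrite /bernoulli_pmf eG.
rewrite (eq_bigr (fun=> 1 - p)).
  by rewrite prodr_const; congr (_ ^+ _); rewrite /N -(cardC (mem G)) addKn; apply: eq_card.
by move=> e eG; rewrite /bernoulli_pmf (negbTE eG).
Qed.

Lemma gnp_card_binomial (a b : nat) :
  \sum_(G : graph n | (a <= #|G| < b)%N) gnp_pmf p G =
  \sum_(a <= k < b) binomial_pmf N p k.
Proof.
transitivity (\sum_(a <= k < b) \sum_(G : graph n | #|G| == k) gnp_pmf p G).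
  under [RHS]eq_bigr do rewrite big_mkcond.
  rewrite exchange_big big_mkcond; apply: eq_bigr => G _.
  case: ifPn => Gab; last first.
    rewrite big_nat big1// => k kab; case: eqP => // Gk.
    by rewrite Gk kab in Gab.
  rewrite (bigD1_seq #|G|) ?iota_uniq ?mem_index_iota//= eqxx big1 ?addr0//.
  by move=> k kG; rewrite eq_sym (negbTE kG).
apply: eq_bigr => k _; rewrite (eq_bigr (fun=> p ^+ k * (1 - p) ^+ (N - k))).
  rewrite sumr_const /binomial_pmf; congr (_ *+ _).
  by rewrite -card_draws; apply: eq_card => G; rewrite !inE.
by move=> G /eqP Gk; rewrite gnp_pmfE Gk.
Qed.

End gnp_mean.

(** * Matchings containing given edges *)

Section matchings.
Context (n : nat).
Implicit Types (S M G : {set edge n}) (e f : edge n).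

(** Its cardinality is the [d(S)] of the overview; for empty [S] it is the set of all
    [l]-matchings. *)
Definition matchings_over l S : {set {set edge n}} :=
  [set M : {set edge n} | is_matching l M & S \subset M]%SET.

Definition vertices S : {set 'I_n} := (\bigcup_(e in S) val e)%SET.

Lemma mem_edge_vertices S e : e \in S -> val e \subset vertices S.
Proof. by move=> eS; apply: (finset.bigcup_sup e). Qed.

Lemma disjoint_vertices S e :
  [disjoint val e & vertices S]%B = [forall f in S, [disjoint val e & val f]%B].
Proof.
apply/idP/forall_inP => [eS f fS|eS].
  by apply: disjointWr eS; exact: mem_edge_vertices.
rewrite finset.disjoints_subset; apply/fintype.subsetP => x xe.
rewrite inE; apply/finset.bigcupP => -[f /eS /pred0P /(_ x)] /=.
by rewrite xe => /= ->.
Qed.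

Lemma card_vertices_le S : (#|vertices S| <= 2 * #|S|)%N.
Proof.
rewrite mulnC -sum_nat_const /vertices.
apply: (big_rec2 (fun (A : {set 'I_n}) m => (#|A| <= m)%N)); first by rewrite cards0.
move=> e m A _ Am; rewrite finset.cardsU; apply: leq_trans (leq_subr _ _) _.
by rewrite leq_add// (eqP (valP e)).
Qed.

Lemma card_edges_in (A : {set 'I_n}) : #|[set e : edge n | val e \subset A]%SET| = 'C(#|A|, 2).
Proof.
rewrite -cards_draws -(card_imset _ val_inj); apply: eq_card => B; rewrite !inE.
apply/imsetP/andP => [[e]|[BA B2]]; first by rewrite inE => eA ->; split => //; exact: (valP e).
by exists (Sub B B2); rewrite ?inE SubK.
Qed.

Lemma card_edge : #|{: edge n}| = 'C(n, 2).
Proof.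
have := card_edges_in [set: 'I_n]%SET; rewrite cardsT card_ord => <-; apply: eq_card => e.
by rewrite !inE finset.subsetT.
Qed.

Lemma card_disjoint_edges S :
  ('C(n - 2 * #|S|, 2) <= #|[set e : edge n | [disjoint val e & vertices S]%B]%SET|)%N.
Proof.
have -> : #|[set e : edge n | [disjoint val e & vertices S]%B]%SET| =
    'C(#|~: vertices S|%SET, 2).
  by rewrite -card_edges_in; apply: eq_card => e; rewrite !inE finset.disjoints_subset.
rewrite leq_bin2l// (finset.cardsCs (~: vertices S)%SET) finset.setCK card_ord.
by rewrite leq_sub2l// card_vertices_le.
Qed.

Lemma is_matchingP l M : reflect (#|M| = l /\
  {in M &, forall e f, e != f -> [disjoint val e & val f]%B}) (is_matching l M).
Proof.
apply: (iffP andP) => [[/eqP Ml /forall_inP MM]|[Ml MM]].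
  by split => // e f eM fM; apply/implyP; exact: (forall_inP (MM e eM)).
split; first exact/eqP.
by apply/forall_inP => e eM; apply/forall_inP => f fM; apply/implyP; exact: MM.
Qed.

(** * Invariance under permutations of the vertices *)

Section relabelling.
Variable sigma : {perm 'I_n}.

Fact edge_perm_subproof e : #|sigma @: val e|%SET == 2.
Proof. by rewrite card_imset ?(valP e)//; exact: perm_inj. Qed.

Definition edge_perm e : edge n := Sub (sigma @: val e)%SET (edge_perm_subproof e).

Lemma edge_perm_inj : injective edge_perm.
Proof.
move=> e f /(congr1 val); rewrite !SubK => ef; apply: val_inj.
exact: (imset_inj perm_inj ef).
Qed.

Lemma is_matching_perm l M : is_matching l M -> is_matching l (edge_perm @: M)%SET.
Proof.
move=> /is_matchingP[Ml MM]; apply/is_matchingP; split.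
  by rewrite card_imset//; exact: edge_perm_inj.
move=> _ _ /imsetP[e eM ->] /imsetP[f fM ->]; rewrite (inj_eq edge_perm_inj) => ef.
by rewrite !SubK imset_disjoint ?MM//; exact: perm_inj.
Qed.

Lemma card_matchings_over_perm l S :
  (#|matchings_over l S| <= #|matchings_over l (edge_perm @: S)%SET|)%N.
Proof.
rewrite -(card_imset _ (imset_inj edge_perm_inj)); apply/subset_leq_card/fintype.subsetP.
move=> _ /imsetP[M + ->]; rewrite !inE => /andP[Ml SM].
by rewrite is_matching_perm// imsetS.
Qed.

End relabelling.

(* Two transpositions carry [e] to [f] and fix every vertex of [S]. *)
Lemma card_matchings_over_disjoint l S e f :
  [disjoint val e & vertices S]%B -> [disjoint val f & vertices S]%B ->
  (#|matchings_over l (e |: S)%SET| <= #|matchings_over l (f |: S)%SET|)%N.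
Proof.
move=> eS fS; have /finset.cards2P[a [b [ab ev]]] := valP e.
have /finset.cards2P[c [d [cd fv]]] := valP f.
(* The first transposition moves [b] when [b = c], so the second one has to start from the image
   [b']. *)
pose b' := tperm a c b.
pose sigma := (tperm a c * tperm b' d)%g.
have b'c : b' != c.
  by rewrite -[c](tpermL a c) (inj_eq perm_inj) eq_sym.
have sa : sigma a = c by rewrite permM tpermL tpermD// eq_sym.
have sb : sigma b = d by rewrite permM tpermL.
have sx x : x \notin [set a; b]%SET -> x \notin [set c; d]%SET -> sigma x = x.
  rewrite !inE !negb_or => /andP[xa xb] /andP[xc xd].
  rewrite permM (tpermD (x := a)) ?(eq_sym _ x)// tpermD ?(eq_sym _ x)//.
  by rewrite /b'; case: tpermP => // ->.
have -> : (f |: S)%SET = (edge_perm sigma @: (e |: S))%SET.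
  rewrite imsetU1; congr (_ |: _)%SET.
    by apply: val_inj; rewrite SubK ev imsetU1 imset_set1 sa sb.
  rewrite -[LHS]imset_id; apply: eq_in_imset => g gS; apply: val_inj.
  rewrite SubK -[LHS]imset_id; apply: eq_in_imset => x xg; rewrite sx//.
    apply/negP; rewrite -ev => xe; move/pred0P : eS => /(_ x) /=.
    by rewrite xe (fintype.subsetP (mem_edge_vertices gS)).
  apply/negP; rewrite -fv => xe; move/pred0P : fS => /(_ x) /=.
  by rewrite xe (fintype.subsetP (mem_edge_vertices gS)).
exact: card_matchings_over_perm.
Qed.

(** Double counting of the pairs of a matching [M] containing [S] and an edge [f] of [M] outside
    [S]. *)
Lemma sum_matchings_over l S :
  (\sum_(f | f \notin S) #|matchings_over l (f |: S)%SET| =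
   (l - #|S|) * #|matchings_over l S|)%N.
Proof.
transitivity (\sum_(f | f \notin S) \sum_(M in matchings_over l S) (f \in M))%N.
  apply: eq_bigr => f fS; rewrite -sum1_card big_mkcond [RHS]big_mkcond.
  apply: eq_bigr => M _; rewrite !inE finset.subUset finset.sub1set.
  by case: (is_matching l M); case: (f \in M); case: (S \subset M).
rewrite exchange_big /= mulnC -sum_nat_const; apply: eq_bigr => M.
rewrite inE => /andP[/is_matchingP[Ml _] SM].
have -> : (l - #|S|)%N = #|M :\: S|%SET by rewrite finset.cardsD (finset.setIidPr SM) Ml.
rewrite -sum1_card [RHS]big_mkcond [LHS]big_mkcond; apply: eq_bigr => f _.
by rewrite !inE; case: (f \in S); case: (f \in M).
Qed.

(** By symmetry every edge lies in equally many matchings, so the sum in [sum_matchings_over] for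
    the empty set is constant. *)
Lemma card_matchings_over_edge l e :
  (#|{: edge n}| * #|matchings_over l [set e]%SET| =
   l * #|matchings_over l finset.set0|)%N.
Proof.
have dis f : [disjoint val f & vertices finset.set0]%B.
  by rewrite disjoint_vertices; apply/forall_inP => g; rewrite inE.
have := sum_matchings_over l finset.set0; rewrite cards0 subn0 => <-.
rewrite -sum_nat_const; apply: eq_big => [f|f _]; first by rewrite !inE.
apply/eqP; rewrite finset.setU0 -{1}[[set e]%SET]finset.setU0 -[[set f]%SET]finset.setU0.
rewrite eqn_leq.
by rewrite !card_matchings_over_disjoint.
Qed.

(** If [e] touches a vertex of [S], no matching contains both. Otherwise all edges avoiding the
    vertices of [S] have equal counts; there are at least ['C(n - 2 * #|S|, 2)] of them, and
    [sum_matchings_over] bounds the total. *)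
Lemma card_matchings_over_extend l S e : e \notin S ->
  ('C(n - 2 * #|S|, 2) * #|matchings_over l (e |: S)%SET| <=
   l * #|matchings_over l S|)%N.
Proof.
move=> eS; have [eV|eV] := boolP [disjoint val e & vertices S]%B; last first.
  rewrite [X in (_ * X)%N](_ : _ = 0) ?muln0//; apply/eqP; rewrite finset.cards_eq0.
  apply/eqP/setP => M; rewrite !inE; apply/negbTE/negP => /andP[/is_matchingP[_ MM]].
  rewrite finset.subUset finset.sub1set => /andP[eM SM]; case/negP: eV.
  rewrite disjoint_vertices; apply/forall_inP => f fS; apply: MM => //.
    exact: (fintype.subsetP SM).
  by apply: contraNneq eS => ->.
apply: leq_trans (_ : (l - #|S|) * #|matchings_over l S| <= _)%N; last first.
  by rewrite leq_mul2r leq_subr orbT.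
rewrite -sum_matchings_over; apply: leq_trans (leq_mul (card_disjoint_edges S) (leqnn _)) _.
rewrite -sum_nat_const big_mkcond [leqRHS]big_mkcond /=; apply: leq_sum => f _.
rewrite inE; case: ifP => // fV; rewrite ifT ?card_matchings_over_disjoint//.
apply/negP => /mem_edge_vertices fS; have /finset.cards2P[c [d [cd fv]]] := valP f.
move/pred0P : fV => /(_ c) /=; rewrite (fintype.subsetP fS) fv !inE eqxx//.
Qed.

(** Edges are removed one at a time. The last one left is counted exactly, with the factor
    [#|{: edge n}|], which makes the leading term of the variance sharp; the others only need the
    cruder ['C(n - 2 * l, 2)]. *)
Lemma card_matchings_over_le l S : S != finset.set0 -> (#|S| <= l)%N ->
  (#|{: edge n}| * 'C(n - 2 * l, 2) ^ #|S|.-1 * #|matchings_over l S| <=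
   l ^ #|S| * #|matchings_over l finset.set0|)%N.
Proof.
move=> S0; have [j] := ubnP #|S|; elim: j => // j IH in S S0 * => Sj Sl.
have /finset.set0Pn[e eS] := S0.
have SE : S = (e |: (S :\ e))%SET by rewrite finset.setD1K.
have cS : #|S| = #|(S :\ e)%SET|.+1 by rewrite (finset.cardsD1 e) eS.
have [T0|T0] := eqVneq (S :\ e)%SET finset.set0.
  rewrite SE T0 finset.setU0 cards1 expn0 muln1 expn1.
  by rewrite card_matchings_over_edge.
have Tj : (#|(S :\ e)%SET| < j)%N by rewrite -ltnS -cS.
have Tl : (#|(S :\ e)%SET| <= l)%N by apply: leq_trans Sl; rewrite cS.
have {}IH := IH _ T0 Tj Tl.
have eT : e \notin (S :\ e)%SET by rewrite !inE eqxx.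
have := card_matchings_over_extend l eT; rewrite -SE => ext.
have le2 : ('C(n - 2 * l, 2) <= 'C(n - 2 * #|(S :\ e)%SET|, 2))%N.
  by rewrite leq_bin2l// leq_sub2l// leq_mul2l Tl orbT.
have T1 : (0 < #|(S :\ e)%SET|)%N by rewrite finset.card_gt0.
rewrite cS /= -[in leqLHS](prednK T1) expnS [in leqRHS]expnS.
apply: leq_trans (_ : l * (#|{: edge n}| * 'C(n - 2 * l, 2) ^ #|(S :\ e)%SET|.-1 *
   #|matchings_over l (S :\ e)%SET|) <= _)%N; last by rewrite -[leqRHS]mulnA leq_mul2l IH orbT.
rewrite [leqLHS](_ : _ = #|{: edge n}| * 'C(n - 2 * l, 2) ^ #|(S :\ e)%SET|.-1 *
   ('C(n - 2 * l, 2) * #|matchings_over l S|))%N; last first.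
  by rewrite -!mulnA; congr (_ * _)%N; rewrite mulnCA.
rewrite [leqRHS](_ : _ = #|{: edge n}| * 'C(n - 2 * l, 2) ^ #|(S :\ e)%SET|.-1 *
   (l * #|matchings_over l (S :\ e)%SET|))%N; last by rewrite mulnCA.
rewrite leq_mul2l; apply/orP; right; apply: leq_trans ext.
by rewrite leq_mul2r le2 orbT.
Qed.

(** Greedy construction: as long as two vertices are free, one more edge fits. *)
Lemma card_matchings_gt0 l : (2 * l <= n)%N -> (0 < #|matchings_over l finset.set0|)%N.
Proof.
suff ex : (2 * l <= n)%N -> exists M, is_matching l M.
  by move=> /ex[M Ml]; apply/card_gt0P; exists M; rewrite inE Ml finset.sub0set.
elim: l => [_|l IH ln].
  exists finset.set0; apply/is_matchingP; split; first by rewrite cards0.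
  by move=> e f; rewrite inE.
have [|S /is_matchingP[Sl SS]] := IH; first by lia.
have : (0 < #|[set e : edge n | [disjoint val e & vertices S]%B]%SET|)%N.
  by apply: leq_trans (card_disjoint_edges S); rewrite bin_gt0 Sl; lia.
case/card_gt0P => e; rewrite inE disjoint_vertices => /forall_inP eS.
have eNS : e \notin S.
  apply/negP => /eS; rewrite -setI_eq0 finset.setIid -finset.cards_eq0.
  by rewrite (eqP (valP e)).
exists (e |: S)%SET; apply/is_matchingP; split; first by rewrite cardsU1 eNS Sl.
move=> f g; rewrite !inE => /orP[/eqP->|fS] /orP[/eqP->|gS]; rewrite ?eqxx// => fg.
- exact: eS.
- by rewrite disjoint_sym; exact: eS.
- exact: SS.
Qed.

End matchings.

(** * Variance of the number of matchings *)

Lemma sum_subsets_expr (R : comNzRingType) (T : finType) (A : {set T}) (t : R) :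
  \sum_(S : {set T} | S \subset A) t ^+ #|S| = (1 + t) ^+ #|A|.
Proof.
have -> : (1 + t) ^+ #|A| = \prod_(i : T) ((if i \in A then t else 0) + 1).
  rewrite -prodr_const big_mkcond; apply: eq_bigr => i _.
  by case: (i \in A); rewrite addrC ?addr0.
rewrite bigA_distr big_mkcond; apply: eq_bigr => S _.
case: ifPn => [SA|/fintype.subsetPn[i iS iA]]; last first.
  by rewrite (bigD1 i)//= iS (negbTE iA) mul0r.
rewrite -prodr_const big_mkcond; apply: eq_bigr => i _.
by case: ifPn => // /(fintype.subsetP SA) ->.
Qed.

(** Bernoulli's inequality in reciprocal form; the induction rests on
    [(1 + t) * (1 - (l + 1) * t) <= 1 - l * t]. *)
Lemma expr1D_bernoulli (R : realDomainType) (t : R) (l : nat) : 0 <= t ->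
  (1 + t) ^+ l * (1 - l%:R * t) <= 1.
Proof.
move=> t0; elim: l => [|l IH]; first by rewrite expr0 mul0r subr0 mulr1.
apply: le_trans IH; rewrite exprSr -mulrA ler_wpM2l ?exprn_ge0 ?addr_ge0//.
rewrite -natr1; have : 0 <= (l%:R + 1) * t ^+ 2 by rewrite mulr_ge0 ?sqr_ge0// addr_ge0.
lra.
Qed.

(** After multiplication by [t], the sum is [(1 + t) ^+ #|A| - 1]. The exponent [#|S|.-1] is that of
    the bound on [d(S)]. *)
Lemma sum_nonempty_subsets_le (R : realFieldType) (T : finType) (A : {set T}) (t : R) :
  0 < t -> #|A|%:R * t < 1 ->
  \sum_(S : {set T} | (S \subset A) && (S != finset.set0)) t ^+ #|S|.-1 <=
  #|A|%:R / (1 - #|A|%:R * t).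
Proof.
move=> t0 At; have At0 : 0 < 1 - #|A|%:R * t by rewrite subr_gt0.
rewrite -(ler_pM2l t0) mulr_sumr.
rewrite (eq_bigr (fun S : {set T} => t ^+ #|S|)); last first.
  by move=> S /andP[_ S0]; rewrite -exprS prednK// finset.card_gt0.
have -> : \sum_(S : {set T} | (S \subset A) && (S != finset.set0)) t ^+ #|S| =
    (1 + t) ^+ #|A| - 1.
  rewrite -sum_subsets_expr [in RHS](bigD1 finset.set0) ?finset.sub0set//=.
  by rewrite cards0 expr0 addrAC subrr add0r.
rewrite mulrA ler_pdivlMr//; have := expr1D_bernoulli #|A| (ltW t0).
lra.
Qed.

Section matching_variance.
Context {R : realType} (n l : nat) (p : R).
Hypothesis p01 : 0 < p < 1.
Hypothesis l_gt0 : (0 < l)%N.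
Hypothesis ln : (2 * l + 2 <= n)%N.

Let M0 := @matchings_over n l finset.set0.
Let m : R := #|M0|%:R.
Let lam := m * p ^+ l.
Let N : R := #|{: edge n}|%:R.
Let N' : R := 'C(n - 2 * l, 2)%:R.
Let eps := l%:R ^+ 2 * (1 - p) / (p * N').

Let p0 : 0 < p. Proof. by case/andP: p01. Qed.
Let q0 : 0 < 1 - p. Proof. by rewrite subr_gt0; case/andP: p01. Qed.
Let p01w : 0 <= p <= 1. Proof. by case/andP: p01 => /ltW -> /ltW ->. Qed.
Let lR0 : 0 < l%:R :> R. Proof. by rewrite ltr0n. Qed.

Let N'0 : 0 < N'. Proof. by rewrite ltr0n bin_gt0; lia. Qed.
Let N0 : 0 < N. Proof. by rewrite ltr0n card_edge bin_gt0; lia. Qed.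
Let m0 : 0 < m. Proof. by rewrite ltr0n card_matchings_gt0//; lia. Qed.
Let lam0 : 0 < lam. Proof. by rewrite mulr_gt0 ?exprn_gt0. Qed.
Let eps0 : 0 < eps. Proof. by rewrite divr_gt0 ?mulr_gt0 ?exprn_gt0. Qed.

Let X : graph n -> R := @matching_count R n l.

Lemma matching_countE G : @matching_count R n l G =
  \sum_(M in @matchings_over n l finset.set0) (M \subset G)%:R.
Proof.
rewrite /matching_count -sum1_card natr_sum big_mkcond [RHS]big_mkcond.
apply: eq_bigr => M _; rewrite !inE finset.sub0set.
by case: (is_matching l M); case: (M \subset G).
Qed.

Let card_M0 M : M \in M0 -> #|M| = l.
Proof. by rewrite inE => /andP[/is_matchingP[]]. Qed.

Lemma mean_matching_count : gnp_mean p (@matching_count R n l) = lam.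
Proof.
rewrite (eq_gnp_mean _ matching_countE) gnp_mean_sum (eq_bigr (fun=> p ^+ l)).
  by rewrite sumr_const /lam /m mulr_natl.
by move=> M /card_M0 Ml; rewrite gnp_mean_subset Ml.
Qed.

Lemma cov_matching_edges :
  gnp_mean p (fun G => (X G - lam) * (#|G|%:R - N * p)) = lam * l%:R * (1 - p).
Proof.
have XE : gnp_mean p (fun G => X G * #|G|%:R) = m * (l%:R * p ^+ l + (N - l%:R) * p ^+ l.+1).
  under eq_gnp_mean do rewrite /X matching_countE mulr_suml.
  rewrite gnp_mean_sum (eq_bigr (fun=> l%:R * p ^+ l + (N - l%:R) * p ^+ l.+1)).
    by rewrite sumr_const /m [RHS]mulr_natl.
  by move=> M /card_M0 Ml; rewrite gnp_mean_subset_edges Ml.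
transitivity (gnp_mean p (fun G => X G * #|G|%:R + ((- (N * p)) * X G +
   (- lam * #|G|%:R + lam * (N * p))))).
  apply: eq_gnp_mean => G; move: (X G) lam (#|G|%:R : R) (N * p).
  by move=> a b c d; lra.
rewrite !gnp_meanD !gnp_meanZ gnp_mean_cst XE mean_matching_count gnp_mean_edges.
rewrite -/N /lam exprS; move: p (l%:R : R) N m (p ^+ l) => a b c d e; lra.
Qed.

Let q := (1 - p) / p.

(* [1 + q = 1 / p], expanded over the subsets of [M :&: M'] *)
Let expr_cardU M M' : M \in M0 -> M' \in M0 -> p ^+ #|M :|: M'|%SET =
  p ^+ l * p ^+ l * \sum_(S : {set edge n} | S \subset M :&: M') q ^+ #|S|.
Proof.
move=> /card_M0 Ml /card_M0 Ml'; rewrite sum_subsets_expr.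
have -> : 1 + q = p^-1 by rewrite /q mulrBl mul1r divff ?gt_eqF// addrC subrK.
have : (#|M :|: M'|%SET + #|M :&: M'|%SET = l + l)%N by rewrite finset.cardsUI Ml Ml'.
rewrite -exprD => <-; rewrite exprD exprVn mulfK// expf_neq0// gt_eqF//.
Qed.

(** [X ^+ 2] is a sum over pairs of matchings; expanding each pair over the subsets [S] of its
    intersection and summing over the second matching first leaves [d(S)]. *)
Lemma matching_second_moment :
  gnp_mean p (fun G => X G ^+ 2) = p ^+ l * p ^+ l *
  \sum_(M in M0) \sum_(S : {set edge n} | S \subset M) q ^+ #|S| * #|matchings_over l S|%:R.
Proof.
under eq_gnp_mean do rewrite expr2 {1}/X matching_countE mulr_suml.
rewrite gnp_mean_sum mulr_sumr; apply: eq_bigr => M MM.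
under eq_gnp_mean do rewrite /X matching_countE mulr_sumr.
rewrite gnp_mean_sum.
under eq_bigr => M' MM' do rewrite gnp_mean_subset2 expr_cardU//.
rewrite -mulr_sumr; congr (_ * _).
under eq_bigr do rewrite big_mkcond.
rewrite exchange_big [RHS]big_mkcond /=; apply: eq_bigr => S _.
rewrite -big_mkcondr /=.
case: ifPn => SM.
  rewrite sumr_const mulr_natr; congr (_ *+ _).
  by apply: eq_card => M'; rewrite unfold_in !inE finset.subsetI SM finset.sub0set andbT.
by rewrite big1// => M'; rewrite finset.subsetI (negbTE SM) andbF.
Qed.

Let v := gnp_mean p (fun G => (X G - lam) ^+ 2).
(** The part of the variance explained by the number of edges: squared covariance divided by the
    variance of the number of edges. *)
Let v1 := lam ^+ 2 * l%:R ^+ 2 * (1 - p) / (N * p).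

Let card_matchings_over_leR (S : {set edge n}) : S != finset.set0 -> (#|S| <= l)%N ->
  #|matchings_over l S|%:R <= m * (l%:R / N) * (l%:R / N') ^+ #|S|.-1.
Proof.
move=> S0 Sl; have := card_matchings_over_le S0 Sl.
have S1 : (0 < #|S|)%N by rewrite finset.card_gt0.
rewrite -{2}(prednK S1) expnS -(ler_nat R) !natrM !natrX -/N -/N' -/m => h.
have -> : m * (l%:R / N) * (l%:R / N') ^+ #|S|.-1 =
    l%:R * l%:R ^+ #|S|.-1 * m / (N * N' ^+ #|S|.-1).
  rewrite expr_div_n invfM; move: m (N^-1) (l%:R : R) (_ ^+ _) (_ ^+ _)^-1.
  by clear h; move=> a b c d e; lra.
by rewrite ler_pdivlMr ?mulr_gt0 ?exprn_gt0// mulrC.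
Qed.

Lemma matching_variance_le : eps < 1 -> v * (1 - eps) <= v1.
Proof.
move=> eps1; pose t := q * (l%:R / N').
have t0 : 0 < t by rewrite !mulr_gt0 ?invr_gt0.
have lt : l%:R * t = eps.
  rewrite /t /q /eps expr2 invfM; move: (p^-1) (N'^-1) (l%:R : R) (1 - p).
  by move=> a b c d; lra.
have e1 : 0 < 1 - eps by rewrite subr_gt0.
(* The empty set contributes exactly [lam ^+ 2], which cancels against the squared mean. *)
have vE : v = p ^+ l * p ^+ l * \sum_(M in M0)
    \sum_(S : {set edge n} | (S \subset M) && (S != finset.set0))
      q ^+ #|S| * #|matchings_over l S|%:R.
  transitivity (gnp_mean p (fun G => X G ^+ 2 + (- 2 * lam * X G + lam ^+ 2))).
    by apply: eq_gnp_mean => G; move: (X G) lam; move=> a b; lra.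
  rewrite !gnp_meanD gnp_meanZ gnp_mean_cst matching_second_moment mean_matching_count.
  under eq_bigr => M _ do rewrite (bigD1 finset.set0) ?finset.sub0set//= cards0 expr0 mul1r.
  rewrite big_split /= sumr_const -/M0 -[_ *+ _]mulr_natr -/m /lam.
  by move: (\sum_(_ in _) _) m (p ^+ l) => a b c; lra.
have q00 : 0 < q by rewrite divr_gt0.
rewrite -ler_pdivlMr// vE.
have bound M : M \in M0 -> \sum_(S : {set edge n} | (S \subset M) && (S != finset.set0))
      q ^+ #|S| * #|matchings_over l S|%:R <= m * (l%:R / N) * q * (l%:R / (1 - eps)).
  move=> /card_M0 Ml.
  have := @sum_nonempty_subsets_le R _ M t t0; rewrite Ml lt => /(_ eps1) h.
  apply: le_trans (ler_wpM2l _ h); last by rewrite !mulr_ge0 ?invr_ge0 ?ltW.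
  rewrite mulr_sumr; apply: ler_sum => S /andP[SM S0].
  have Sl : (#|S| <= l)%N by rewrite -Ml subset_leq_card.
  have S1 : (0 < #|S|)%N by rewrite finset.card_gt0.
  apply: le_trans (ler_wpM2l _ (card_matchings_over_leR S0 Sl)) _.
    by rewrite exprn_ge0// ltW.
  rewrite /t (exprMn _ q) -{1}(prednK S1) exprS.
  move: m q (l%:R / N) ((l%:R / N') ^+ _) (q ^+ _) => a b c d e; lra.
apply: le_trans (ler_wpM2l _ (ler_sum _ bound)) _.
  by rewrite mulr_ge0 ?exprn_ge0// ltW.
rewrite sumr_const -/M0 -[_ *+ _]mulr_natr -/m.
rewrite le_eqVlt; apply/orP; left; apply/eqP.
rewrite /v1 /lam /q !exprMn [(N * p)^-1]invfM.
move: (p ^+ l) m (l%:R : R) (1 - p) (p^-1) (N^-1) (1 - eps)^-1.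
by clear vE bound => a b c d e f g; lra.
Qed.

(* Cauchy-Schwarz: the residual of the regression of [X] on the number of edges
   has nonnegative variance. *)
Lemma matching_variance_ge : v1 <= v.
Proof.
(* The regression slope: covariance over variance, with the common factor [1 - p] cancelled. *)
pose c := lam * l%:R / (N * p).
have Np : N * p != 0 by rewrite mulf_neq0 ?gt_eqF.
have cN : c * (N * p) = lam * l%:R by rewrite /c divfK.
have := gnp_mean_ge0 p01w (fun G => sqr_ge0 ((X G - lam) - c * (#|G|%:R - N * p))).
rewrite (@eq_gnp_mean _ _ _ _ (fun G => (X G - lam) ^+ 2 +
  ((- 2 * c) * ((X G - lam) * (#|G|%:R - N * p)) +
   c ^+ 2 * (#|G|%:R - N * p) ^+ 2))); last first.
  by move=> G; move: (X G) lam (#|G|%:R : R) (N * p) => a b e f; lra.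
rewrite !gnp_meanD !gnp_meanZ gnp_var_edges// cov_matching_edges -/v -/N.
have -> : v1 = c * (c * (N * p)) * (1 - p).
  rewrite cN /v1 /c; move: lam (l%:R : R) (1 - p) (N * p)^-1.
  by move=> a b d e; lra.
rewrite -cN; move: v (N * p) (1 - p) => a b e h; lra.
Qed.

Lemma matching_variance_gt0 : 0 < v.
Proof.
by apply: lt_le_trans matching_variance_ge; rewrite divr_gt0 ?mulr_gt0 ?exprn_gt0.
Qed.

(** The distance is [2 - 2 * rho] with [rho] the correlation, and [rho ^+ 2 = v1 / v] is at least
    [1 - eps]. As [0 < 1 - eps < 1], this forces [rho >= 1 - eps]. *)
Lemma standardized_matching_edges_dist : eps < 1 ->
  gnp_mean p (fun G => ((X G - lam) / Num.sqrt v -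
     (#|G|%:R - N * p) / Num.sqrt (N * p * (1 - p))) ^+ 2) <= 2 * eps.
Proof.
move=> eps1; have v0 := matching_variance_gt0.
have s20 : 0 < N * p * (1 - p) by rewrite !mulr_gt0.
set a := Num.sqrt v; set s := Num.sqrt _.
have a0 : 0 < a by rewrite sqrtr_gt0.
have s0 : 0 < s by rewrite sqrtr_gt0.
have a2 : a ^+ 2 = v by rewrite sqr_sqrtr// ltW.
have s2 : s ^+ 2 = N * p * (1 - p) by rewrite sqr_sqrtr// ltW.
rewrite (@eq_gnp_mean _ _ _ _ (fun G => (a^-1 ^+ 2) * (X G - lam) ^+ 2 +
  ((- 2 * a^-1 * s^-1) * ((X G - lam) * (#|G|%:R - N * p)) +
   s^-1 ^+ 2 * (#|G|%:R - N * p) ^+ 2))); last first.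
  move=> G; move: (X G) lam (a^-1) (s^-1) (#|G|%:R : R) (N * p).
  by move=> b c d e f g; lra.
rewrite !gnp_meanD !gnp_meanZ gnp_var_edges// cov_matching_edges -/v -/N -a2 -s2.
rewrite -!exprMn !mulVf ?gt_eqF// !expr1n.
set rho := a^-1 * s^-1 * (lam * l%:R * (1 - p)).
have rho0 : 0 < rho by rewrite !mulr_gt0 ?invr_gt0 ?exprn_gt0.
have rho2 : rho ^+ 2 * v = v1.
  have -> : rho ^+ 2 * v = (a^-1 * a) ^+ 2 * (lam * l%:R * (1 - p)) ^+ 2 / s ^+ 2.
    rewrite -a2 /rho -(exprVn s); move: (a^-1) (s^-1) (lam * l%:R * (1 - p)).
    by move=> c d e; lra.
  rewrite mulVf ?gt_eqF// expr1n mul1r s2 /v1.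
  have -> : (lam * l%:R * (1 - p)) ^+ 2 = lam ^+ 2 * l%:R ^+ 2 * (1 - p) * (1 - p).
    by move: lam (l%:R : R) (1 - p) => b c d; lra.
  by rewrite -[in LHS]mulf_div divff ?mulr1// gt_eqF.
have : 1 - eps <= rho ^+ 2.
  have := matching_variance_le eps1; rewrite -rho2 => h.
  by rewrite -(ler_pM2r v0) mulrC.
move=> h; have : 1 - eps <= rho.
  rewrite leNgt; apply/negP => h2; have : rho * rho < 1 * (1 - eps).
    by apply: ltr_pM => //; [exact: ltW|exact: ltW|apply: lt_le_trans h2 _; rewrite gerBl ltW].
  by rewrite mul1r ltNge -expr2 h.
have -> : - 2 * a^-1 * s^-1 * (lam * l%:R * (1 - p)) = - 2 * rho by rewrite /rho !mulrA.
lra.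
Qed.

End matching_variance.

(** * Central limit theorem for the number of edges *)

Section edge_clt.
Context {R : realType}.

Section fixed_graph.
Variables (n : nat) (p : R).
Hypothesis p01 : 0 < p < 1.

Let N : nat := #|{: edge n}|.
Let s : R := Num.sqrt (N%:R * p * (1 - p)).
Let h := s^-1.

Definition edges_cdf (x : R) : R :=
  \sum_(G : graph n | (#|G|%:R - N%:R * p) / s <= x) gnp_pmf p G.

Let p01w : 0 <= p <= 1. Proof. by case/andP: p01 => /ltW -> /ltW ->. Qed.

Let pmf_ge0 (G : graph n) : 0 <= gnp_pmf p G. Proof. exact: gnp_pmf_ge0. Qed.

Lemma gnp_pmf_sum_le1 (P : pred (graph n)) : \sum_(G : graph n | P G) gnp_pmf p G <= 1.
Proof.
by rewrite -(gnp_pmf_sum1 n p) big_mkcond ler_sum// => G _; case: ifP.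
Qed.

(** Transfers [binomial_normal_window] to the number of edges. By Chebyshev's inequality the mass
    outside the window is at most [K ^- 2], which is lost in passing from [edges_cdf x] to [A] and
    from 1 to [B]. *)
Lemma edges_cdf_bounds (K x : R) (D := 2 * K * (2 * (K + 1) ^+ 2 + 1) + 2 * (K + 1)) :
  0 < s -> 1 <= K -> - K <= x <= K -> (K + 1) * h <= 1 / 2 ->
  (edges_cdf x - K ^- 2) * (normal_cdf K - normal_cdf (- K + h)) <=
    expR (D * h) * normal_cdf (x + h) /\
  (1 - K ^- 2) * (normal_cdf x - normal_cdf (- K + h)) <= expR (D * h) * edges_cdf x.
Proof.
move=> s0 K1 xK Kh.
have K0 : 0 <= K by apply: le_trans K1.
have Kgt0 : 0 < K by apply: lt_le_trans K1.
have h0 : 0 < h by rewrite invr_gt0.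
have h1' : h <= 1 by have := mulr_ge0 K0 (ltW h0); lra.
have tail : \sum_(G : graph n | K <= `|(#|G|%:R - N%:R * p) / s|) gnp_pmf p G <= K ^- 2.
  apply: le_trans (gnp_chebyshev p01w (f := fun G => (#|G|%:R - N%:R * p) / s) Kgt0 _) _.
    by [].
  rewrite (@eq_gnp_mean _ _ _ _ (fun G => (s ^- 2) * (#|G|%:R - N%:R * p) ^+ 2)).
    rewrite gnp_meanZ gnp_var_edges// sqr_sqrtr; last first.
      by case/andP: p01w => *; rewrite !mulr_ge0// subr_ge0.
    rewrite mulVf ?mul1r// gt_eqF//; move: s0; rewrite /s sqrtr_gt0//.
  by move=> G; rewrite exprMn exprVn mulrC.
have win (y : R) : (forall G : graph n, ((Num.truncn (N%:R * p - K * s)).+1 <= #|G| <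
     (Num.truncn (N%:R * p + y * s)).+1)%N = false ->
     (#|G|%:R - N%:R * p) / s <= y -> K <= `|(#|G|%:R - N%:R * p) / s|).
  move=> G; case: leqP => /= [Gm _ _|_ Gy].
    rewrite ler_normr; apply/orP; right; rewrite lerNr ler_pdivrMr// lerBlDl mulNr.
    by move: Gm; rewrite truncn_ge_nat// (binomial_window_ge0 p01 s0 Kh).
  rewrite ler_pdivrMr// lerBlDl => Gle; exfalso; move: Gy; rewrite ltnS.
  by rewrite truncn_ge_nat ?Gle//; apply: le_trans Gle.
pose A := \sum_(G : graph n | ((Num.truncn (N%:R * p - K * s)).+1 <= #|G| <
     (Num.truncn (N%:R * p + x * s)).+1)%N) gnp_pmf p G.
pose B := \sum_(G : graph n | ((Num.truncn (N%:R * p - K * s)).+1 <= #|G| <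
     (Num.truncn (N%:R * p + K * s)).+1)%N) gnp_pmf p G.
have B1 : B <= 1 by exact: gnp_pmf_sum_le1.
have := binomial_normal_window p01 s0 K0 Kh xK.
rewrite -!(gnp_card_binomial n p) -/A -/B => /(_ B1)[h1 h2].
have FA : edges_cdf x - K ^- 2 <= A.
  rewrite lerBlDr; apply: le_trans (lerD (lexx A) tail).
  rewrite /A /edges_cdf [leLHS]big_mkcond [X in _ <= X + _]big_mkcond.
  rewrite [X in _ <= _ + X]big_mkcond -big_split /=; apply: ler_sum => G _.
  case: ifPn => [Gx|_]; last by rewrite addr_ge0//; case: ifP.
  case: ifPn => [_|/negbTE/win/(_ Gx) ->]; last by rewrite add0r.
  by rewrite lerDl; case: ifP.
have AF : A <= edges_cdf x.
  rewrite /A /edges_cdf [leLHS]big_mkcond [leRHS]big_mkcond; apply: ler_sum => G _.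
  case: ifPn => [/andP[Gm Gx]|_]; last by case: ifP.
  case: ifPn => // /negP[]; rewrite ler_pdivrMr// lerBlDl.
  (* [truncn] vanishes on negative reals, so its positivity shows that its argument is
     nonnegative. *)
  have {}Gm : (0 < #|G|)%N by apply: leq_trans Gm.
  move: Gx; rewrite ltnS => Gx.
  have := leq_trans Gm Gx; rewrite Num.Theory.truncn_gt0 => pos.
  by rewrite -truncn_ge_nat// (le_trans _ pos).
have KB : 1 - K ^- 2 <= B.
  rewrite lerBlDr; apply: le_trans (lerD (lexx B) tail).
  rewrite -[leLHS](gnp_pmf_sum1 n p) /B [X in _ <= X + _]big_mkcond.
  rewrite [X in _ <= _ + X]big_mkcond -big_split /=; apply: ler_sum => G _.
  case: ifPn => [_|/negbTE/win GK]; first by rewrite lerDl; case: ifP.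
  rewrite add0r ifT//; have [GK'|GK'] := leP ((#|G|%:R - N%:R * p) / s) K.
    exact: GK.
  by rewrite ler_normr (ltW GK').
split.
  apply: le_trans h1; apply: ler_wpM2r => //; rewrite subr_ge0.
  by apply: normal_cdf_nondecreasing; lra.
(* The bound on [B] can be multiplied only by a nonnegative factor; in the other case the left side
   is at most 0. *)
have [c0|c0] := leP 0 (normal_cdf x - normal_cdf (- K + h)).
  apply: le_trans (ler_wpM2r c0 KB) (le_trans h2 _).
  by apply: ler_wpM2l => //; exact: expR_ge0.
apply: (@le_trans _ _ 0).
  apply: mulr_ge0_le0; last exact: ltW.
  by rewrite subr_ge0 invf_le1 ?exprn_gt0// exprn_ege1.
by rewrite mulr_ge0 ?expR_ge0//; apply: sumr_ge0.
Qed.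

End fixed_graph.

(** The window [K] is chosen first, from [x] and [e]; the mesh is then made small, since [D] depends
    on [K]. The threshold is uniform in [n] and [p], which lets [p] vary with [n]. *)
Lemma edges_cdf_cvg (x e : R) : 0 < e -> exists2 S : R, 0 < S &
  forall (n : nat) (p : R), 0 < p < 1 ->
    S <= Num.sqrt (#|{: edge n}|%:R * p * (1 - p)) ->
    `|edges_cdf n p x - normal_cdf x| <= e.
Proof.
(* The upper bound at the end loses [7 * d]: [3 * d] from the normal mass of the window, [d] from
   Chebyshev's inequality, and [3 * d] from the factor [expR (D * h)] and the shift by [h]. The
   lower bound loses less. *)
move=> e0; pose d : R := Num.min e 1 / 7.
have d0 : 0 < d by rewrite divr_gt0// lt_min e0 ltr01.
have [de d1] : 7 * d <= e /\ 7 * d <= 1.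
  by rewrite /d mulrC divfK// !ge_min !lexx orbT.
have [K [K1 xK Kd cK cNK]] : exists K : R, [/\ 1 <= K, `|x| <= K, K ^- 2 <= d,
    1 - d <= normal_cdf K & normal_cdf (- K) <= d].
  have cN : \forall K \near +oo, normal_cdf (- K : R) <= d.
    have : normal_cdf (- K) @[K --> +oo] --> (0 : R).
      by have := @cvg_normal_cdfNy R; rewrite cvgNy_compNP.
    move/cvgrPdist_le => /(_ _ d0); apply: filterS => K.
    by rewrite sub0r normrN => /(le_trans (ler_norm _)).
  have c1 : \forall K \near +oo, 1 - d <= normal_cdf (K : R).
    have := @cvg_normal_cdfy R; move/cvgrPdist_le => /(_ _ d0); apply: filterS => K.
    by move/(le_trans (ler_norm _)); lra.
  have cd : \forall K \near +oo, K ^- 2 <= d.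
    near=> K; have K1 : 1 <= K by near: K; exact: nbhs_pinfty_ge.
    have Kd : d^-1 <= K by near: K; apply: nbhs_pinfty_ge; exact: num_real.
    rewrite -[leRHS]invrK lef_pV2 ?posrE ?invr_gt0// ?exprn_gt0 ?(lt_le_trans _ K1)//.
    by apply: le_trans Kd _; rewrite expr2 ler_peMl// (le_trans _ K1).
  near (+oo : set_system R) => K; exists K; split.
  - by near: K; exact: nbhs_pinfty_ge.
  - by near: K; apply: nbhs_pinfty_ge; exact: num_real.
  - by near: K.
  - by near: K.
  - by near: K.
pose D := 2 * K * (2 * (K + 1) ^+ 2 + 1) + 2 * (K + 1).
have near0 (f : R -> R) : {for 0, continuous f} ->
    \forall t \near 0, f t <= f 0 + d.
  move=> /cvgrPdist_le /(_ _ d0); apply: filterS => t.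
  by rewrite distrC => /(le_trans (ler_norm _)); lra.
have fE : \forall t \near (0 : R), expR (D * t) <= 1 + d.
  have := @near0 (fun t => expR (D * t)); rewrite mulr0 expR0; apply.
  apply: continuous_comp; last exact: continuous_expR.
  exact: mulrl_continuous.
have shift (a : R) : \forall t \near (0 : R), normal_cdf (a + t) <= normal_cdf a + d.
  have := @near0 (fun t => normal_cdf (a + t)); rewrite addr0; apply.
  apply: (@continuous_comp _ _ _ (fun t => a + t)); last exact: normal_cdf_continuous.
  by apply: cvgD; [exact: cvg_cst|exact: cvg_id].
have hK : \forall t \near (0 : R), (K + 1) * t <= 1 / 2.
  have : (K + 1) * t @[t --> (0 : R)] --> (K + 1) * 0.
    exact: mulrl_continuous.
  rewrite mulr0 => /cvgrPdist_le /(_ (1 / 2) ltac:(lra)); apply: filterS => t.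
  by rewrite sub0r normrN => /(le_trans (ler_norm _)).
have [r /= r0 near_r] : \forall t \near (0 : R), [/\ expR (D * t) <= 1 + d,
    normal_cdf (x + t) <= normal_cdf x + d,
    normal_cdf (- K + t) <= normal_cdf (- K) + d & (K + 1) * t <= 1 / 2].
  near=> t; split; near: t; [exact: fE|exact: shift|exact: shift|exact: hK].
(* The factor 2 makes the mesh [s^-1] strictly smaller than the radius [r]. *)
exists (2 / r); first by rewrite divr_gt0.
move=> n p p01 sr.
set s := Num.sqrt _ in sr.
have s0 : 0 < s by apply: lt_le_trans sr; rewrite divr_gt0.
have [|eh xh Kh K1h] := near_r s^-1.
  rewrite /= sub0r normrN gtr0_norm ?invr_gt0// -[ltRHS]invrK ltf_pV2 ?posrE ?invr_gt0//.
  apply: lt_le_trans sr; rewrite -[ltLHS]mul1r ltr_pM2r ?invr_gt0//; lra.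
have xK' : - K <= x <= K by rewrite -ler_norml.
have [] := edges_cdf_bounds p01 s0 K1 xK' K1h.
rewrite -/s -/D.
set F := edges_cdf _ _ _; set cx := normal_cdf x.
have F0 : 0 <= F by apply: sumr_ge0 => G _; apply: gnp_pmf_ge0; case/andP: p01 => /ltW -> /ltW ->.
have F1 : F <= 1 by exact: gnp_pmf_sum_le1.
have cx0 : 0 <= cx by exact: normal_cdf_ge0.
have cx1 : cx <= 1 by exact: normal_cdf_le1.
move: xh Kh eh Kd cK cNK; rewrite -/cx.
move: (normal_cdf_ge0 (x + s^-1)) (expR_ge0 (D * s^-1)).
move: (normal_cdf_ge0 (- K + s^-1)) (normal_cdf_le1 K).
have : 0 <= K ^- 2 by rewrite invr_ge0 sqr_ge0.
move: (normal_cdf (x + s^-1)) (normal_cdf (- K + s^-1)) (normal_cdf K)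
  (normal_cdf (- K)) (expR _) (K ^- 2) => a b c c' E k.
clear -d0 d1 de F0 F1 cx0 cx1.
move=> k0 b0 c1 a0 E0 ha hb hE hk hc hc' U L.
have Ea : E * a <= (1 + d) * (cx + d) by apply: ler_pM.
have EF : E * F <= (1 + d) * F by apply: ler_wpM2r.
rewrite ler_norml; apply/andP; split.
  (* In this case [cx <= b <= 2 * d], and the lower bound follows from [0 <= F]. *)
  have [cb|cb] := leP (cx - b) 0; first by lra.
  have : k * (cx - b) <= k * 1 by rewrite ler_wpM2l//; lra.
  have : d * F <= d * 1 by rewrite ler_wpM2l// ltW.
  lra.
have [Fk|Fk] := leP (F - k) 0; first by lra.
have : (F - k) * (1 - 3 * d) <= (F - k) * (c - b).
  by rewrite ler_wpM2l//; lra.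
have : (F - k) * (3 * d) <= 1 * (3 * d) by rewrite ler_wpM2r//; lra.
have : d * cx <= d * 1 by rewrite ler_wpM2l// ltW.
have : d * d <= d * 1 by rewrite ler_wpM2l//; lra.
lra.
Unshelve. all: by end_near. Qed.

(** If [f G <= x], then [g G <= x + d] unless [f] and [g] differ by at least [d], an event
    controlled by Chebyshev's inequality. *)
Lemma gnp_cdf_transfer (n : nat) (p c x d : R) (f g : graph n -> R) :
  0 <= p <= 1 -> 0 < d ->
  gnp_mean p (fun G => (f G - g G) ^+ 2) <= c ->
  \sum_(G : graph n | f G <= x) gnp_pmf p G <=
    \sum_(G : graph n | g G <= x + d) gnp_pmf p G + c / d ^+ 2.
Proof.
move=> p01 d0 fgc.
have := @gnp_chebyshev R n p p01 (fun G => f G - g G)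
  (fun G => d <= `|f G - g G|) d d0 (fun _ => id).
have c2 : gnp_mean p (fun G => (f G - g G) ^+ 2) / d ^+ 2 <= c / d ^+ 2.
  by rewrite ler_pM2r// invr_gt0 exprn_gt0.
move=> /le_trans /(_ c2) cheb; apply: le_trans (lerD (lexx _) cheb).
rewrite [leLHS]big_mkcond [X in _ <= X + _]big_mkcond.
rewrite [X in _ <= _ + X]big_mkcond -big_split /=; apply: ler_sum => G _.
have pG := gnp_pmf_ge0 G p01.
case: ifPn => [fx|_]; last by rewrite addr_ge0//; case: ifP.
case: ifPn => [_|]; first by rewrite lerDl; case: ifP.
rewrite -ltNge => gx; rewrite add0r ifT// ler_normr; apply/orP; right; lra.
Qed.

End edge_clt.

(** * Proof of the theorem *)

Lemma natr_bin2 (R : realFieldType) (k : nat) : 'C(k, 2)%:R = k%:R * (k%:R - 1) / 2 :> R.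
Proof.
have -> : k%:R * (k%:R - 1) = ('C(k, 2) * 2)%:R :> R.
  have -> : ('C(k, 2) * 2 = k * k.-1)%N by have := bin_ffact k 2; rewrite !ffactnS ffactn0 muln1.
  by case: k => [|k]; rewrite ?mul0r// natrM /= -natr1 addrK.
by rewrite natrM mulfK// pnatr_eq0.
Qed.

(** As [1 <= l], the bound on [l] forces [n * sqrt p >= 1 / eta >= 8]. Hence [l <= n / 8] and
    ['C(n - 2 * l, 2) >= n ^ 2 / 8], while the variance of the number of edges is at least
    [n ^ 2 * p * k / 4], which exceeds [S ^+ 2]. *)
Lemma matching_regime (R : realType) (n l : nat) (p k eta S : R) :
  0 < p < 1 -> (0 < l)%N -> 0 < k <= 1 - p -> 0 < eta <= 1 / 8 ->
  l%:R <= eta * (n%:R * Num.sqrt p) -> 0 <= S -> 4 * eta * S ^+ 2 <= k ->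
  [/\ (2 * l + 2 <= n)%N,
    l%:R ^+ 2 * (1 - p) / (p * 'C(n - 2 * l, 2)%:R) <= eta &
    S <= Num.sqrt (#|{: edge n}|%:R * p * (1 - p))].
Proof.
move=> /andP[p0 p1] l0 /andP[k0 kp] /andP[eta0 eta8] lle S0 Sk.
have l1 : 1 <= l%:R :> R by rewrite ler1n.
move: lle; set a := Num.sqrt p; set x : R := n%:R => lle.
have a0 : 0 < a by rewrite sqrtr_gt0.
have a2 : a ^+ 2 = p by rewrite sqr_sqrtr// ltW.
have a1 : a <= 1 by rewrite -sqrtr1 ler_sqrt// ltW.
have x0 : 0 <= x by rewrite ler0n.
have xa0 : 0 <= x * a by rewrite mulr_ge0// ltW.
have l8 : l%:R <= x * a / 8.
  by apply: le_trans lle _; rewrite mulrC [leRHS]mulrC mulrC ler_wpM2r//; lra.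
have xa8 : 8 <= x * a by lra.
have xax : x * a <= x by rewrite ler_piMr.
have ln : (2 * l + 2 <= n)%N.
  by rewrite -(ler_nat R) natrD natrM -/x; lra.
have ln' : (2 * l <= n)%N := leq_trans (leq_addr 2 _) ln.
split => //.
- have N'ge : x ^+ 2 / 8 <= 'C(n - 2 * l, 2)%:R :> R.
    rewrite natr_bin2 natrB// natrM -/x.
    have y1 : 3 / 4 * x <= x - 2 * l%:R by lra.
    have y2 : 5 / 8 * x <= x - 2 * l%:R - 1 by lra.
    have : (3 / 4 * x) * (5 / 8 * x) <= (x - 2 * l%:R) * (x - 2 * l%:R - 1).
      by apply: ler_pM => //; lra.
    have : 0 <= x ^+ 2 by exact: sqr_ge0.
    lra.
  have x20 : 0 < x ^+ 2 by rewrite exprn_gt0//; lra.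
  have N'0 : 0 < 'C(n - 2 * l, 2)%:R :> R by apply: lt_le_trans N'ge; lra.
  rewrite ler_pdivrMr ?mulr_gt0//.
  apply: (@le_trans _ _ (eta ^+ 2 * (x * a) ^+ 2)).
    rewrite -exprMn -[leRHS]mulr1; apply: ler_pM => //; rewrite ?sqr_ge0//; try lra.
    by rewrite lerXn2r ?nnegrE// mulr_ge0// ltW.
  apply: (@le_trans _ _ (eta * (p * (x ^+ 2 / 8)))); last first.
    by rewrite ler_pM2l// ler_pM2l.
  have -> : eta ^+ 2 * (x * a) ^+ 2 = eta * (p * (x ^+ 2 * eta)) by rewrite exprMn a2; lra.
  by rewrite ler_pM2l// ler_pM2l// ler_pM2l//; lra.
- rewrite -[leLHS]ger0_norm// -sqrtr_sqr; apply: ler_wsqrtr.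
  rewrite card_edge natr_bin2 -/x.
  have N4 : x ^+ 2 / 4 <= x * (x - 1) / 2.
    have : x * 2 <= x * x by rewrite ler_wpM2l//; lra.
    lra.
  apply: (@le_trans _ _ (x ^+ 2 / 4 * p * k)); last first.
    by rewrite ler_pM//; rewrite ?mulr_ge0 ?invr_ge0// ?sqr_ge0 ?ler_pM2r//; lra.
  have : 1 <= eta * (x * a) by lra.
  have ex : 0 <= eta * (x * a) by rewrite mulr_ge0// ltW.
  move=> h; have h2 : 1 <= (eta * (x * a)) ^+ 2 by rewrite exprn_ege1.
  have S20 : 0 <= S ^+ 2 by exact: sqr_ge0.
  apply: (@le_trans _ _ ((eta * (x * a)) ^+ 2 * S ^+ 2)); first by rewrite ler_peMl.
  have -> : (eta * (x * a)) ^+ 2 * S ^+ 2 = (x ^+ 2 / 4 * p) * (eta * (4 * eta * S ^+ 2)).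
    by rewrite !exprMn a2; lra.
  apply: ler_wpM2l; first by rewrite !mulr_ge0 ?invr_ge0// ?ltW.
  have : eta * (4 * eta * S ^+ 2) <= eta * k by rewrite ler_pM2l.
  have : eta * k <= 1 * k by rewrite ler_pM2r//; lra.
  lra.
Qed.

Theorem theorem2 (R : realType) (p : nat -> R) (l : nat -> nat)
    (p01 : forall n, 0 < p n < 1)
    (p_away1 : (fun n => 1 - p n : R^o) =Omega_\oo (fun=> 1 : R^o))
    (l_gt0 : forall n, (0 < l n)%N)
    (l_small : (fun n => (l n)%:R : R^o) =o_\oo
               (fun n => n%:R * Num.sqrt (p n) : R^o)) :
  cvg_in_distribution (fun n => gnp n (p n))
    (fun n => standardize (gnp n (p n)) (@matching_count R n (l n)))
    (normal_prob 0 1).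
Proof.
move=> x _.
have p01w n : 0 <= p n <= 1 by case/andP: (p01 n) => /ltW -> /ltW ->.
pose H n := \sum_(G : graph n | standardize (gnp n (p n)) (@matching_count R n (l n)) G <= x)
  gnp_pmf (p n) G.
have cdfE n : cdf (P := gnp n (p n))
    (standardize (gnp n (p n)) (@matching_count R n (l n))) x = (H n)%:E.
  by rewrite /H -gnpE.
suff : (H n)%:E @[n --> \oo] --> (normal_cdf x)%:E.
  by rewrite -normal_cdfE -(funext cdfE).
apply: cvg_EFin; first exact: nearW.
apply/cvgrPdist_le => /= e e0.
have [k k0 pk] : exists2 k : R, 0 < k & \forall n \near \oo, k <= 1 - p n.
  have Omega (f g : nat -> R^o) : f =Omega_\oo g ->
      exists2 k : R, 0 < k & \forall n \near \oo, k * `|g n| <= `|f n|.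
    by move=> ->; exact: bigOmegaP.
  have [k k0 pk] := Omega _ _ p_away1.
  exists k => //; apply: filterS pk => n; rewrite normr1 mulr1 ger0_norm//.
  by rewrite subr_ge0; case/andP: (p01w n).
have e3 : 0 < e / 3 by rewrite divr_gt0.
have [d d0 [xd1 xd2]] : exists2 d : R, 0 < d &
    normal_cdf (x + d) <= normal_cdf x + e / 3 /\ normal_cdf x - e / 3 <= normal_cdf (x - d).
  have /cvgrPdist_le /(_ _ e3) [r /= r0 xr] := @normal_cdf_continuous R x.
  exists (r / 2); first by rewrite divr_gt0.
  have r2 : `|r / 2| < r by rewrite gtr0_norm ?divr_gt0//; lra.
  split.
    have := xr (x + r / 2); rewrite /= opprD addrA subrr sub0r normrN => /(_ r2).
    by rewrite ler_norml; lra.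
  have := xr (x - r / 2); rewrite /= opprD opprK addrA subrr add0r => /(_ r2).
  by rewrite ler_norml; lra.
have [S1 S10 clt1] := edges_cdf_cvg (x + d) e3.
have [S2 S20 clt2] := edges_cdf_cvg (x - d) e3.
pose S := Num.max S1 S2.
have S0 : 0 < S by rewrite lt_max S10.
(* The first two bounds are those of [matching_regime]; the third makes the Chebyshev error
   [2 * eta / d ^+ 2] at most [e / 3]. *)
pose eta := Num.min (1 / 8) (Num.min (k / (4 * S ^+ 2)) (e * d ^+ 2 / 6)).
have eta0 : 0 < eta.
  by rewrite !lt_min !divr_gt0 ?mulr_gt0 ?exprn_gt0//= ltr0n.
have eta8 : eta <= 1 / 8 by rewrite ge_min lexx.
have etaS : 4 * eta * S ^+ 2 <= k.
  have : eta <= k / (4 * S ^+ 2) by rewrite !ge_min lexx !orbT.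
  by rewrite ler_pdivlMr ?mulr_gt0 ?exprn_gt0//; lra.
have etae : 2 * eta / d ^+ 2 <= e / 3.
  have : eta <= e * d ^+ 2 / 6 by rewrite !ge_min lexx !orbT.
  by rewrite ler_pdivrMr ?exprn_gt0//; lra.
have /eqoP /(_ _ eta0) small := l_small.
near=> n.
have kn : k <= 1 - p n by near: n.
have ln : (l n)%:R <= eta * (n%:R * Num.sqrt (p n)).
  have : `|(l n)%:R : R^o| <= eta * `|n%:R * Num.sqrt (p n) : R^o| by near: n.
  by rewrite !ger0_norm// mulr_ge0 ?sqrtr_ge0.
have kk : 0 < k <= 1 - p n by rewrite k0.
have eta08 : 0 < eta <= 1 / 8 by rewrite eta0.
have [l2 epsn Sn] := matching_regime (p01 n) (l_gt0 n) kk eta08 ln (ltW S0) etaS.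
pose f (G : graph n) := standardize (gnp n (p n)) (@matching_count R n (l n)) G.
pose g (G : graph n) := (#|G|%:R - #|{: edge n}|%:R * p n) /
  Num.sqrt (#|{: edge n}|%:R * p n * (1 - p n)).
have fE G : f G = (@matching_count R n (l n) G - gnp_mean (p n) (@matching_count R n (l n))) /
    Num.sqrt (gnp_mean (p n) (fun G => (@matching_count R n (l n) G -
      gnp_mean (p n) (@matching_count R n (l n))) ^+ 2)).
  by rewrite /f /standardize gnp_expectation// gnp_variance.
have fg : gnp_mean (p n) (fun G => (f G - g G) ^+ 2) <= 2 * eta.
  under eq_gnp_mean do rewrite fE mean_matching_count//.
  apply: le_trans (standardized_matching_edges_dist (p01 n) (l_gt0 n) l2 _) _.
    by apply: le_lt_trans epsn _; lra.
  by rewrite ler_pM2l.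
have gf : gnp_mean (p n) (fun G => (g G - f G) ^+ 2) <= 2 * eta.
  by under eq_gnp_mean do rewrite -sqrrN opprB.
(* [H n] is squeezed between the distribution functions of the number of edges at [x - d] and
   [x + d]. Each side loses [e / 3] to Chebyshev's inequality, to the central limit theorem and to
   the continuity of [normal_cdf]. *)
have t1 := gnp_cdf_transfer x (p01w n) d0 fg.
have t2 := gnp_cdf_transfer (x - d) (p01w n) d0 gf.
rewrite subrK in t2.
have c1 := clt1 n (p n) (p01 n) (le_trans _ Sn).
have {c1} := c1 ltac:(by rewrite le_max lexx).
have c2 := clt2 n (p n) (p01 n) (le_trans _ Sn).
have {c2} := c2 ltac:(by rewrite le_max lexx orbT).
rewrite /edges_cdf !ler_norml => /andP[c1 c2] /andP[c3 c4].
rewrite -/(H n) in t1 t2.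
move: t1 t2; rewrite /g.
set F1 := \sum_(G | _ <= x + d) _ in c1 c2 c3 c4 *.
set F2 := \sum_(G | _ <= x - d) _ in c1 c2 c3 c4 *.
move=> t1 t2.
apply/andP; split; lra.
Unshelve. all: by end_near. Qed.
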